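(* Let $\mathscr B$ be a uniformly convex family of Banach spaces, additionally closed under duality, conjugation, ultraproducts and $L^2$-Lebesgue–Bochner tensor products, and let $\Gamma$ be a countable, discrete, residually finite group (whose box spaces are monogenic). Then the following are equivalent: (1) $\Gamma$ has strong Banach property (T) with respect to $\mathscr B$; (2) all box spaces of $\Gamma$ have geometric strong Banach property (T) with respect to $\mathscr B$ and $\mathcal D_\ell$; (3) there exists a box space of $\Gamma$ which has geometric strong Banach property (T) with respect to $\mathscr B$ and $\mathcal D_\ell$.
   Context: Representations here are unital algebra homomorphisms into $\mathcal L(B)$, $B\in\mathscr B$, and are not assumed isometric or contractive. With $\delta_B(t)=\inf\{1-\|\xi+\eta\|/2:\|\xi\|=\|\eta\|=1,\|\xi-\eta\|\ge t\}$, $\mathscr B$ is uniformly convex if $\inf_{B\in\mathscr B}\delta_B(t)>0$ for $t\in(0,2]$. Closed under $L^2$-Lebesgue–Bochner tensor product: $B\in\mathscr B$ implies $L^2(\mu,B)\in\mathscr B$ for every measure space. Closed under ultraproducts: for $(B_n)\subseteq\mathscr B$ and a non-principal ultrafilter $\omega$ on $\mathbb N$, the bounded sequences in $\prod B_n$ modulo those with $\lim_\omega\|\xi_n\|=0$, with norm $\lim_\omega\|\xi_n\|$, form a member of $\mathscr B$. Groups. For a length function $\ell$ on $\Gamma$ and $s,c>0$, a representation $\pi:\Gamma\to\mathcal L(B)$ has $(\ell,s,c)$-small exponential growth if $\|\pi(\gamma)\|\le c\,e^{s\ell(\gamma)}$ for all $\gamma$. $\mathcal C_{\ell,s,c}(\Gamma)$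 is the completion of $C_c(\Gamma)$ in the norm $\|f\|_{\ell,s,c}=\sup\|\pi(f)\|$ over all such $\pi$ on all $B\in\mathscr B$; since $\mathscr B$ is closed under duality and conjugation, the usual involution extends isometrically. $\Gamma$ has strong Banach property (T) with respect to $\mathscr B$ if for every length function $\ell$ there is $s>0$ such that for every $c>0$ the Banach algebra $\mathcal C_{\ell,s,c}(\Gamma)$ has a Kazhdan projection, i.e. a selfadjoint idempotent $p$ such that $\pi(p)$ is a projection onto the space of invariant vectors for every $\pi$ with $(\ell,s,c)$-small exponential growth. Metric spaces. Let $(X,d)$ be a countable extended metric space of bounded geometry ($\sup_x\#B(x,R)<\infty$ for all $R$) which is monogenic: an entourage is a subset of $\{(x,y):d(x,y)\le R\}$ for some $R$, and some entourage $E_0$ has the property that every entourage lies in an $n$-fold composition $E_0^{\circ n}$. $\mathbb C_u[X]$ is the algebra of complex matrices $T=(T_{xy})_{x,y\in X}$ with uniformly bounded entries whose support $\{(x,y):T_{xy}\neq0\}$ is an entourage; $T^*$ is the conjugate transpose. A partial translation is $V\in\mathbb C_u[X]$ with entries in $\{0,1\}$ and at most one nonzero entry in each row and column; $R_V=\{x:\exists y,V_{xy}=1\}$. A vector $\xi$ is invariant for $\pi$ if $\pi(V)\xi=\pi(\chi_{R_V})\xi$ for all partial translations $V$. A metric $\delta$ on $X$ is finer than $d$ if every entourage of $d$ is an entourage of $\delta$; $\mathrm{Prop}_\delta(T)=\sup\{\delta(x,y):T_{xy}\ne0\}$. A representation $\pi:\mathbb C_u[X]\to\mathcal L(B)$ has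 $(\delta,s,c)$-small exponential growth if $\|\pi(V)\|\le c\,e^{s\,\mathrm{Prop}_\delta(V)}$ for every partial translation $V$. $\mathcal C_{\delta,s,c}(X)$ is the completion of $\mathbb C_u[X]$ in the norm $\sup\|\pi(T)\|$ over all such $\pi$ on all $B\in\mathscr B$, with the isometric involution extending $T\mapsto T^*$. For a set $\mathcal D$ of metrics finer than $d$, $X$ has geometric strong Banach property (T) with respect to $\mathscr B$ and $\mathcal D$ if for every $\delta\in\mathcal D$ there is $s>0$ such that for every $c>0$, $\mathcal C_{\delta,s,c}(X)$ has a Kazhdan projection, i.e. a selfadjoint idempotent $p$ such that $\pi(p)$ is a projection onto the space of invariant vectors for every $\pi$ with $(\delta,s,c)$-small exponential growth. Box spaces. For a nested sequence $\Gamma\trianglerighteq N_1\trianglerighteq N_2\trianglerighteq\cdots$ of finite index normal subgroups with trivial intersection, the box space is $\bigsqcup_n\Gamma/N_n$ with each $\Gamma/N_n$ carrying the quotient metric of the metric on $\Gamma$ given by a proper length function, and distance $\infty$ between distinct pieces; call this metric $d$. Any length function on $\Gamma$ likewise induces (via quotients) a metric on the box space finer than $d$; $\mathcal D_\ell$ is the set of all metrics so induced by length functions on $\Gamma$. *)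

(* Defs.v *)
From HB Require Import structures.
From mathcomp Require Import all_boot all_order all_algebra.
From mathcomp Require Import all_classical all_reals all_analysis.
From mathcomp Require Import complex.

Set Implicit Arguments.
Unset Strict Implicit.
Unset Printing Implicit Defensive.

Import Order.TTheory GRing.Theory Num.Theory.
Import numFieldNormedType.Exports.

Local Open Scope classical_set_scope.
Local Open Scope ring_scope.
Local Open Scope complex_scope.

Notation Banach R := (completeNormedModType R[i]).

Section Operators.
Context {R : realType}.
Implicit Types V W : normedModType R[i].

(* The norm of a normed space over [R[i]] takes its (real) values in [R[i]]. *)
Definition rnorm V (x : V) : R := complex.Re `|x|.

Definition opnorm V W (f : V -> W) : \bar R :=
  ereal_sup [set (rnorm (f x))%:E | x in [set x : V | rnorm x <= 1]].

Definition bounded_op V W (f : V -> W) : Prop := linear f /\ continuous f.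

End Operators.

Section UniformConvexity.
Context {R : realType}.

Definition convexity_modulus (B : Banach R) (t : R) : \bar R :=
  ereal_inf [set a | exists x y : B,
    [/\ rnorm x = 1, rnorm y = 1, t <= rnorm (x - y)
      & a = (1 - rnorm (x + y) / 2)%:E]].

Definition uniformly_convex (BB : Banach R -> Prop) : Prop :=
  forall t : R, 0 < t <= 2 ->
    (0 < ereal_inf [set a | exists2 B, BB B & a = convexity_modulus B t])%E.

End UniformConvexity.

(* Dual, conjugate, ultraproduct and L^2 space are described up to isometric
   isomorphism: [is_xxx .. E] says that the Banach space [E] is a model of the
   construction.  A family is closed under the construction when it contains
   such a model. *)
Section Constructions.
Context {R : realType}.
Implicit Types B E : Banach R.

Definition is_dual B E : Prop :=
  exists Phi : E -> B -> R[i]^o,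
    [/\ forall e, bounded_op (Phi e),
        forall a e e' x, Phi (a *: e + e') x = a * Phi e x + Phi e' x,
        forall e, opnorm (Phi e) = (rnorm e)%:E
      & forall phi : B -> R[i]^o, bounded_op phi -> exists e, Phi e = phi].

Definition is_conjugate B E : Prop :=
  exists J : B -> E,
    [/\ forall a x y, J (a *: x + y) = a^* *: J x + J y,
        forall x, rnorm (J x) = rnorm x
      & forall e, exists x, J x = e].

Definition bounded_family (B : nat -> Banach R) (xi : forall n, B n) : Prop :=
  exists M : R, forall n, rnorm (xi n) <= M.

Definition nonprincipal (w : set_system nat) : Prop :=
  forall n, ~ w [set n].

Definition is_ultraproduct (w : set_system nat) (B : nat -> Banach R) E : Prop :=
  exists Phi : (forall n, B n) -> E,
    [/\ forall a xi eta, bounded_family xi -> bounded_family eta ->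
          Phi (fun n => a *: xi n + eta n) = a *: Phi xi + Phi eta,
        forall xi, bounded_family xi ->
          (fun n => rnorm (xi n)) @ w --> rnorm (Phi xi)
      & forall e, exists2 xi, bounded_family xi & Phi xi = e].

Section L2.
Context d (T : measurableType d) (mu : {measure set T -> \bar R}).

Definition simple_function B (s : T -> B) : Prop :=
  finite_set (range s) /\ forall v, measurable (s @^-1` [set v]).

Definition strongly_measurable B (f : T -> B) : Prop :=
  exists2 s : nat -> T -> B, forall n, simple_function (s n)
    & forall t, (fun n => s n t) @ \oo --> f t.

Definition L2_function B (f : T -> B) : Prop :=
  strongly_measurable f /\ (\int[mu]_t ((rnorm (f t)) ^+ 2)%:E < +oo)%E.

Definition is_L2 B E : Prop :=
  exists Phi : (T -> B) -> E,
    [/\ forall a f g, L2_function f -> L2_function g ->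
          Phi (fun t => a *: f t + g t) = a *: Phi f + Phi g,
        forall f, L2_function f ->
          ((rnorm (Phi f)) ^+ 2)%:E = (\int[mu]_t ((rnorm (f t)) ^+ 2)%:E)%E
      & forall e, exists2 f, L2_function f & Phi f = e].

End L2.

Definition closed_duality (BB : Banach R -> Prop) : Prop :=
  forall B, BB B -> exists2 E, BB E & is_dual B E.

Definition closed_conjugation (BB : Banach R -> Prop) : Prop :=
  forall B, BB B -> exists2 E, BB E & is_conjugate B E.

Definition closed_ultraproducts (BB : Banach R -> Prop) : Prop :=
  forall (w : set_system nat) (B : nat -> Banach R),
    UltraFilter w -> nonprincipal w -> (forall n, BB (B n)) ->
    exists2 E, BB E & is_ultraproduct w B E.

Definition closed_L2 (BB : Banach R -> Prop) : Prop :=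
  forall (d : measure_display) (T : measurableType d)
    (mu : {measure set T -> \bar R}) B, BB B ->
    exists2 E, BB E & is_L2 mu B E.

End Constructions.

(* [A] is a *-algebra with carrier in [V] and operations [mul], [star]; for each
   Banach space [B], [Rep B] is a type, [adm B] selects the admissible
   representations in it, [ev pi f] is the operator pi(f) for f in [A], and
   [inv pi] is the space of invariant vectors. *)
Section Kazhdan.
Context {R : realType} (BB : Banach R -> Prop).
Context (V : zmodType) (A : set V) (mul : V -> V -> V) (star : V -> V).
Context (Rep : Banach R -> Type).
Context (adm : forall B : Banach R, Rep B -> Prop).
Context (ev : forall B : Banach R, Rep B -> V -> B -> B).
Context (inv : forall B : Banach R, Rep B -> set B).

(* 0 is added only so that the supremum over no representation is 0. *)
Definition rep_norm (f : V) : \bar R :=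
  ereal_sup ([set 0%E] `|` [set a | exists B : Banach R, BB B /\
    exists2 pi : Rep B, adm pi & a = opnorm (ev pi f)]).

(* The (Hausdorff) completion of [A] for [rep_norm] is the set of Cauchy
   sequences of [A] modulo [completion_eq]; operations are termwise. *)
Definition completion_elt (p : nat -> V) : Prop :=
  (forall n, A (p n)) /\
  forall e : R, 0 < e -> exists n0 : nat, forall m n : nat,
    (n0 <= m)%N -> (n0 <= n)%N -> (rep_norm (p m - p n)%R < e%:E)%E.

Definition completion_eq (p q : nat -> V) : Prop :=
  forall e : R, 0 < e -> \forall n \near \oo, (rep_norm (p n - q n)%R < e%:E)%E.

(* [P] is the value at [p] of the extension of [pi] to the completion, that is
   the limit of the pi(p_n) in operator norm. *)
Definition completion_ev (B : Banach R) (pi : Rep B) (p : nat -> V)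
    (P : B -> B) : Prop :=
  bounded_op P /\
  forall e : R, 0 < e ->
    \forall n \near \oo, (opnorm (fun x => (ev pi (p n) x - P x)%R) < e%:E)%E.

Definition projection_onto (B : Banach R) (P : B -> B) (Y : set B) : Prop :=
  (forall x, P (P x) = P x) /\ range P = Y.

Definition kazhdan_projection (p : nat -> V) : Prop :=
  [/\ completion_elt p,
      completion_eq (fun n => star (p n)) p,
      completion_eq (fun n => mul (p n) (p n)) p
    & forall B : Banach R, BB B -> forall pi : Rep B, adm pi ->
        exists2 P : B -> B, completion_ev pi p P & projection_onto P (inv pi)].

End Kazhdan.

Section Groups.
Context {R : realType} (G : groupType).

Definition length_function (l : G -> R) : Prop :=
  [/\ l 1%g = 0, forall g, 0 <= l g, forall g, l g^-1%g = l g
    & forall g h, l (g * h)%g <= l g + l h].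

(* A length function for which [l (g^-1 * h)] is a metric with finite balls. *)
Definition proper_length_function (l : G -> R) : Prop :=
  [/\ length_function l, forall g, l g = 0 -> g = 1%g
    & forall r : R, finite_set [set g | l g <= r]].

Definition group_rep (B : Banach R) (pi : G -> B -> B) : Prop :=
  [/\ forall g, bounded_op (pi g), pi 1%g = id
    & forall g h, pi (g * h)%g = pi g \o pi h].

Definition group_small_growth (l : G -> R) (s c : R)
    (B : Banach R) (pi : G -> B -> B) : Prop :=
  group_rep pi /\ forall g, (opnorm (pi g) <= (c * expR (s * l g))%:E)%E.

Definition Cc : set (G -> R[i]) := [set f | finite_set [set g | f g != 0]].

Definition convolution (f f' : G -> R[i]) : G -> R[i] :=
  fun g => \sum_(h \in [set: G]) f h * f' (h^-1 * g)%g.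

Definition group_star (f : G -> R[i]) : G -> R[i] := fun g => (f g^-1%g)^*.

Definition integrated_rep (B : Banach R) (pi : G -> B -> B) (f : G -> R[i]) :
    B -> B :=
  fun x => \sum_(g \in [set: G]) f g *: pi g x.

Definition group_invariants (B : Banach R) (pi : G -> B -> B) : set B :=
  [set x | forall g, pi g x = x].

Definition strong_Banach_T (BB : Banach R -> Prop) : Prop :=
  forall l : G -> R, length_function l ->
  exists2 s : R, 0 < s & forall c : R, 0 < c ->
  exists p : nat -> G -> R[i],
    kazhdan_projection BB Cc convolution group_star (group_small_growth l s c)
      integrated_rep group_invariants p.

End Groups.

Section MetricSpaces.
Context {R : realType} (X : choiceType).
Implicit Types (d delta : X -> X -> \bar R) (T V : X -> X -> R[i]).

Definition entourage_of d (E : set (X * X)) : Prop :=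
  exists r : R, forall x y, E (x, y) -> (d x y <= r%:E)%E.

Definition comp_set (E F : set (X * X)) : set (X * X) :=
  [set z | exists y, E (z.1, y) /\ F (y, z.2)].

Fixpoint comp_pow (E : set (X * X)) (n : nat) : set (X * X) :=
  if n is n'.+1 then comp_set E (comp_pow E n') else [set z | z.1 = z.2].

Definition monogenic d : Prop :=
  exists2 E0, entourage_of d E0 &
    forall E, entourage_of d E -> exists n, E `<=` comp_pow E0 n.

Definition Cu d : set (X -> X -> R[i]) :=
  [set T | (exists M : R, forall x y, `|T x y| <= M%:C) /\
           entourage_of d [set z | T z.1 z.2 != 0]].

(* For banded matrices over a space of bounded geometry the sum is finite. *)
Definition mx_mul T T' : X -> X -> R[i] :=
  fun x z => \sum_(y \in [set: X]) T x y * T' y z.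

Definition mx_star T : X -> X -> R[i] := fun x y => (T y x)^*.

Definition mx_chi (D : set X) : X -> X -> R[i] :=
  fun x y => ((x == y) && (x \in D))%:R.

Definition partial_translation d V : Prop :=
  [/\ Cu d V, forall x y, V x y = 0 \/ V x y = 1,
      forall x y y', V x y != 0 -> V x y' != 0 -> y = y'
    & forall x x' y, V x y != 0 -> V x' y != 0 -> x = x'].

Definition pt_range V : set X := [set x | exists y, V x y = 1].

(* Equal to -oo for T = 0; then the growth bound below reads ||pi(0)|| <= 0. *)
Definition propagation delta T : \bar R :=
  ereal_sup [set a | exists x y, T x y != 0 /\ a = delta x y].

Definition space_rep d (B : Banach R) (pi : (X -> X -> R[i]) -> B -> B) : Prop :=
  [/\ forall T, Cu d T -> bounded_op (pi T),
      pi (mx_chi setT) = id,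
      forall (a : R[i]) T T', Cu d T -> Cu d T' ->
        pi (fun x y => a * T x y + T' x y) = (fun xi => a *: pi T xi + pi T' xi)
    & forall T T', Cu d T -> Cu d T' -> pi (mx_mul T T') = pi T \o pi T'].

Definition space_small_growth d delta (s c : R)
    (B : Banach R) (pi : (X -> X -> R[i]) -> B -> B) : Prop :=
  space_rep d pi /\
  forall V, partial_translation d V ->
    (opnorm (pi V) <= c%:E * expeR (s%:E * propagation delta V))%E.

Definition space_invariants d (B : Banach R)
    (pi : (X -> X -> R[i]) -> B -> B) : set B :=
  [set xi | forall V, partial_translation d V ->
              pi V xi = pi (mx_chi (pt_range V)) xi].

Definition geometric_strong_Banach_T (BB : Banach R -> Prop) d
    (D : set (X -> X -> \bar R)) : Prop :=
  forall delta, D delta ->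
  exists2 s : R, 0 < s & forall c : R, 0 < c ->
  exists p : nat -> X -> X -> R[i],
    kazhdan_projection BB (Cu d) mx_mul mx_star
      (space_small_growth d delta s c)
      (fun B (pi : (X -> X -> R[i]) -> B -> B) => pi) (space_invariants d) p.

End MetricSpaces.

Section BoxSpaces.
Context {R : realType} (G : groupType).

Definition lcoset (g : G) (N : set G) : set G := [set (g * h)%g | h in N].

Definition finite_index_normal (N : set G) : Prop :=
  [/\ N 1%g, forall g h, N g -> N h -> N (g * h^-1)%g,
      forall g h, N h -> N (h ^ g)%g
    & finite_set (range (fun g => lcoset g N))].

Definition residually_finite : Prop :=
  forall g : G, g != 1%g -> exists2 N, finite_index_normal N & ~ N g.

Definition box_sequence (N : nat -> set G) : Prop :=
  [/\ forall n, finite_index_normal (N n), forall n, N n.+1 `<=` N n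
    & \bigcap_n N n = [set 1%g]].

(* Points are pairs (n, C) with C a coset of N_n, i.e. an element of G / N_n. *)
Definition box (N : nat -> set G) : choiceType :=
  {z : nat * set G | `[< exists g, z.2 = lcoset g (N z.1) >]}.

(* On G / N_n, the quotient of the metric l (g^-1 * h) on G. *)
Definition box_dist (N : nat -> set G) (l : G -> R) (x y : box N) : \bar R :=
  if (val x).1 == (val y).1 then
    ereal_inf [set a | exists g h,
      [/\ (val x).2 g, (val y).2 h & a = (l (g^-1 * h)%g)%:E]]
  else +oo%E.

Definition Dl (N : nat -> set G) : set (box N -> box N -> \bar R) :=
  [set delta | exists2 l, length_function l & delta = box_dist l].

End BoxSpaces.

(* Main.v *)
Require Import Defs.
From HB Require Import structures.
From mathcomp Require Import all_boot all_order all_algebra.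
From mathcomp Require Import all_classical all_reals all_analysis.
From mathcomp Require Import complex measurable_realfun ring lra.

Set Implicit Arguments.
Unset Strict Implicit.
Unset Printing Implicit Defensive.

Import Order.TTheory GRing.Theory Num.Theory.
Import numFieldNormedType.Exports.

Local Open Scope classical_set_scope.
Local Open Scope ring_scope.
Local Open Scope complex_scope.

(** Right translation by g in G is a partial translation V_g of every box
    space, so a representation of C_u restricts to one of G, with the same growth
    constants and the same invariant vectors: a partial translation of bounded
    propagation is a finite sum of diagonal cut-downs of the V_g. Hence a Kazhdan
    projection of G maps to one of the box space.

    Conversely let pi be a representation of G on B. Matrices of bounded
    propagation act on the ultraproduct E of the L2(G/N_n; B) by
    f V_g |-> f V_g (x) pi(g); this is multiplicative and has the right growth
    since, for a proper length, G and G/N_n agree on any ball for large n. The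
    constant functions embed B into E, and averaging over G/N_n sends
    T = sum_g f_g V_g to Phi(T) = sum_g (lim_n avg f_g) g in C_c(G), with
    |pi(Phi(T)) v| <= |T v| for v in B. So Phi is contractive and commutes with
    left translations, and it maps a Kazhdan projection of the box space to one
    of G. *)

(** * Real-valued norms of complex Banach spaces *)

(** Since pi does not factor through G/N_n, at a single level f V_g (x) pi(g) depends on which
    element of g N_n is used, and multiplicativity can fail on shallow levels. For bounded
    propagation the choice is unique on deep levels, and the ultraproduct forgets the others. L2
    norms for the averaging measure give a constant its own norm and dominate the norm of an
    average.

    Phi is not multiplicative, so p p = p does not pass directly to Phi(p). Instead, equivariance
    under left translations, Phi(1) = 1 and contractivity show that pi(Phi(p_n)) converges to an
    operator whose range is invariant and which fixes invariant vectors, hence to a projection. The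
    rate of convergence is common to all pi, which makes the limit idempotent in a norm that is a
    supremum over all pi. Selfadjointness passes because Phi commutes with the involution. *)

Section RealNorm.
Context {R : realType}.
Implicit Types V W : normedModType R[i].

Definition cabs (a : R[i]) : R := complex.Re `|a|.

Lemma normr_rnorm V (x : V) : `|x| = (rnorm x)%:C.
Proof. by rewrite /rnorm RRe_real// normr_real. Qed.

Lemma normr_cabs (a : R[i]) : `|a| = (cabs a)%:C.
Proof. by rewrite /cabs RRe_real// normr_real. Qed.

Lemma rnorm_ge0 V (x : V) : 0 <= rnorm x.
Proof. by rewrite -ler0c -normr_rnorm. Qed.

Lemma cabs_ge0 (a : R[i]) : 0 <= cabs a.
Proof. by rewrite -ler0c -normr_cabs. Qed.

Lemma rnormD V (x y : V) : rnorm (x + y) <= rnorm x + rnorm y.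
Proof. by rewrite -lecR rmorphD/= -!normr_rnorm ler_normD. Qed.

Lemma rnormZ V a (x : V) : rnorm (a *: x) = cabs a * rnorm x.
Proof. by apply: complexI; rewrite rmorphM/= -!normr_rnorm -normr_cabs normrZ. Qed.

Lemma rnormN V (x : V) : rnorm (- x) = rnorm x.
Proof. by rewrite /rnorm normrN. Qed.

Lemma rnorm0 V : rnorm (0 : V) = 0.
Proof. by rewrite /rnorm normr0. Qed.

Lemma rnorm_eq0 V (x : V) : rnorm x = 0 -> x = 0.
Proof. by move=> x0; apply/normr0_eq0; rewrite normr_rnorm x0. Qed.

Lemma rnormBC V (x y : V) : rnorm (x - y) = rnorm (y - x).
Proof. by rewrite -rnormN opprB. Qed.

Lemma rnormB V (x y : V) : rnorm (x - y) <= rnorm x + rnorm y.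
Proof. by rewrite -(rnormN y) rnormD. Qed.

Lemma rnorm_triB V (x y z : V) : rnorm (x - z) <= rnorm (x - y) + rnorm (y - z).
Proof. by rewrite -[x - z](subrKA y) rnormD. Qed.

Lemma rnorm_sum V (I : Type) (s : seq I) (P : pred I) (F : I -> V) :
  rnorm (\sum_(i <- s | P i) F i) <= \sum_(i <- s | P i) rnorm (F i).
Proof.
elim/big_ind2 : _ => [|x a y b xa yb|//]; first by rewrite rnorm0.
by apply: le_trans (rnormD _ _) _; rewrite lerD.
Qed.

Lemma cabsD (a b : R[i]) : cabs (a + b) <= cabs a + cabs b.
Proof. exact: (@rnormD R[i]^o). Qed.

Lemma cabsM (a b : R[i]) : cabs (a * b) = cabs a * cabs b.
Proof. exact: (@rnormZ R[i]^o). Qed.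

Lemma cabs0 : cabs 0 = 0.
Proof. exact: (@rnorm0 R[i]^o). Qed.

Lemma cabs_real (a : R) : 0 <= a -> cabs a%:C = a.
Proof. by move=> a0; rewrite /cabs ger0_norm ?ler0c. Qed.

Lemma cabs_conj (a : R[i]) : cabs a^* = cabs a.
Proof. by rewrite /cabs normcJ. Qed.

Lemma cabs_ReIm (a : R[i]) :
  cabs a <= `|complex.Re a| + `|complex.Im a|.
Proof.
rewrite {1}(complexE a); apply: (le_trans (cabsD _ _)); rewrite cabsM.
have cabsR (x : R) : cabs x%:C = `|x|.
  by apply: complexI; rewrite -normr_cabs normc_def/= expr0n addr0 sqrtr_sqr.
by rewrite !cabsR lerD// {1}/cabs normc_def/= expr0n expr1n add0r sqrtr1 mul1r.
Qed.

Lemma Re_cabs (a : R[i]) : `|complex.Re a| <= cabs a.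
Proof. by rewrite -lecR -normr_cabs normc_ge_Re. Qed.

Lemma Im_cabs (a : R[i]) : `|complex.Im a| <= cabs a.
Proof.
rewrite -lecR -normr_cabs normc_def lecR -sqrtr_sqr ler_wsqrtr//.
by rewrite lerDr sqr_ge0.
Qed.

Lemma complete_rnorm (B : Banach R) (u : nat -> B) :
  (forall e : R, 0 < e -> exists n0 : nat, forall m n : nat,
    (n0 <= m)%N -> (n0 <= n)%N -> rnorm (u m - u n) < e) ->
  exists x, forall e : R, 0 < e -> exists n0 : nat, forall n : nat,
    (n0 <= n)%N -> rnorm (u n - x) < e.
Proof.
move=> cu.
have : cvgn u.
  apply/cauchy_cvgP/cauchyP => e e0.
  have e'0 : 0 < complex.Re e.
    by move: e0; rewrite ltcE/= => /andP[].
  have ee : e = (complex.Re e)%:C by rewrite RRe_real// gtr0_real.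
  have [n0 h] := cu _ e'0; exists (u n0).
  exists n0 => // n /= n0n.
  by rewrite -ball_normE/= ee normr_rnorm ltcR h.
move=> /cvgrPdist_lt cu'; exists (limn u) => e e0.
have /cu'[n0 _ h] : 0 < e%:C by rewrite ltcR.
exists n0 => n nn; have := h n nn.
by rewrite /= normr_rnorm ltcR rnormBC.
Qed.

Section LinearProp.
Variables (U U' : lmodType R[i]) (f : U -> U').
Hypothesis lf : linear f.

Lemma linear_prop0 : f 0 = 0.
Proof.
have := lf 1 0 0; rewrite scaler0 add0r scale1r -[X in X = _]addr0.
by move=> /addrI.
Qed.

Lemma linear_propZ a x : f (a *: x) = a *: f x.
Proof. by rewrite -[a *: x]addr0 lf linear_prop0 addr0. Qed.

Lemma linear_propD x y : f (x + y) = f x + f y.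
Proof. by rewrite -[x in LHS]scale1r lf scale1r. Qed.

Lemma linear_propB x y : f (x - y) = f x - f y.
Proof. by rewrite linear_propD -scaleN1r linear_propZ scaleN1r. Qed.

Lemma linear_prop_sum (I : Type) (s : seq I) (P : pred I) (F : I -> U) :
  f (\sum_(i <- s | P i) F i) = \sum_(i <- s | P i) f (F i).
Proof. exact: (big_morph _ linear_propD linear_prop0). Qed.

End LinearProp.

Lemma bounded_op_intro V W (f : V -> W) (K : R) :
  linear f -> (forall x, rnorm (f x) <= K * rnorm x) -> bounded_op f.
Proof.
move=> lf fK; split => //.
pose L := @GRing.isLinear.Build _ _ _ _ f lf.
pose F : {linear V -> W} := HB.pack f L.
apply: (@bounded_linear_continuous _ _ _ F); apply/linear_boundedP.
near=> r => x; rewrite /= !normr_rnorm.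
apply: (@le_trans _ _ (K%:C * (rnorm x)%:C)).
  by rewrite -rmorphM/= lecR fK.
rewrite ler_wpM2r ?ler0c ?rnorm_ge0//; near: r.
apply: nbhs_pinfty_ge; exact/complex_realP/(ex_intro _ K).
Unshelve. all: by end_near. Qed.

Lemma opnorm_le V W (f : V -> W) (K : R) : 0 <= K ->
  (forall x, rnorm (f x) <= K * rnorm x) -> (opnorm f <= K%:E)%E.
Proof.
move=> K0 fK; apply: ge_ereal_sup => _ [x /= x1 <-]; rewrite lee_fin.
by apply: (le_trans (fK x)); rewrite ler_piMr.
Qed.

Lemma opnorm_bound V W (f : V -> W) (K : R) : linear f ->
  (opnorm f <= K%:E)%E -> forall x, rnorm (f x) <= K * rnorm x.
Proof.
move=> lf fK x.
have fZ := linear_propZ lf.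
have [x0|x0] := eqVneq (rnorm x) 0.
  rewrite x0 mulr0 (rnorm_eq0 x0) -(scale0r 0) fZ scale0r.
  by rewrite rnorm0.
have x1 : 0 < rnorm x by rewrite lt_def x0 rnorm_ge0.
have : ((rnorm (f ((rnorm x)^-1%:C *: x)))%:E <= opnorm f)%E.
  apply: ereal_sup_ubound; exists ((rnorm x)^-1%:C *: x) => //=.
  by rewrite rnormZ cabs_real ?invr_ge0 ?rnorm_ge0// mulVf.
move=> /le_trans/(_ fK); rewrite lee_fin fZ rnormZ.
rewrite cabs_real ?invr_ge0 ?rnorm_ge0//.
by rewrite ler_pdivrMl// mulrC.
Qed.

End RealNorm.

(** * Ultrafilter limits and finite L2 spaces *)

Section Ultrafilters.
Context {R : realType}.

Lemma nonprincipal_ultrafilter_exists :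
  exists2 w : set_system nat, UltraFilter w & nonprincipal w.
Proof.
have [w [wU ow]] := @ultraFilterLemma nat \oo _.
exists w => // n wn.
have wS : w [set m | (n < m)%N] by apply: ow; exists n.+1.
have [m [/= -> ]] := filter_ex (filterI wn wS).
by rewrite ltnn.
Qed.

Variables (w : set_system nat) (wU : UltraFilter w).

(** The ultrafilter contains the complement of each point; finitely many such complements intersect
    in a tail. *)
Lemma nonprincipal_tail : nonprincipal w -> forall n0, w [set n | (n0 <= n)%N].
Proof.
move=> wn; elim=> [|n0 IH]; first by apply: filterS filterT.
have [//|wC] := @in_ultra_setVsetC _ _ [set n0] wU; first by move=> /wn.
apply: filterS (filterI IH wC) => n /= [n0n /eqP nn0].
by rewrite ltn_neqAle eq_sym nn0.
Qed.

(** By compactness of [-M, M] there is a cluster point. If the set where u is close to it were not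
    in [w], its complement would be, and clustering contradicts this. *)
Lemma ultra_real_limit (u : nat -> R) (M : R) : (forall n, `|u n| <= M) ->
  exists r : R, forall e : R, 0 < e -> w [set n | `|u n - r| < e].
Proof.
move=> uM.
have [|r [_ rcl]] := @segment_compact R (- M) M (u @ w) _.
  apply: (@filterS _ w _ setT); last exact: filterT.
  by move=> n _; rewrite /= in_itv/= -ler_norml.
exists r => e e0.
have [//|wC] := @in_ultra_setVsetC _ _ [set n | `|u n - r| < e] wU.
have [||x [/= xe]] := rcl (u @` (~` [set n | `|u n - r| < e])) (ball r e).
- by apply: (@filterS _ w _ _ _ _ wC) => n /= nn; exists n.
- exact: (nbhsx_ballx _ _ e0).
by case: xe => n /= + <-; rewrite /ball/= distrC.
Qed.

Lemma ultra_complex_limit (u : nat -> R[i]) (M : R) : (forall n, cabs (u n) <= M) ->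
  exists a, forall e : R, 0 < e -> w [set n | cabs (u n - a) < e].
Proof.
move=> uM.
have [n|r hr] := @ultra_real_limit (fun n => complex.Re (u n)) M.
  by apply: le_trans (uM n); exact: Re_cabs.
have [n|s hs] := @ultra_real_limit (fun n => complex.Im (u n)) M.
  by apply: le_trans (uM n); exact: Im_cabs.
exists (r +i* s) => e e0.
have e2 : 0 < e / 2 by rewrite divr_gt0.
apply: filterS (filterI (hr _ e2) (hs _ e2)) => n /= [nr ns].
apply: (le_lt_trans (cabs_ReIm _)); rewrite (splitr e).
by case: (u n) nr ns => a b /= nr ns; rewrite ltrD.
Qed.

End Ultrafilters.

Section FiniteL2.
Context {R : realType}.

(** The closure hypothesis is applied to 1/m times the sum of the Dirac masses at i < m. This
    measure lives on [nat], where every function is measurable, so the same domain serves all m. *)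
Lemma finite_L2_model (BB : Banach R -> Prop) (B : Banach R) (m : nat) :
  closed_L2 BB -> BB B ->
  exists E : Banach R, BB E /\ exists Phi : (nat -> B) -> E,
    [/\ forall a f g, Phi (fun t => a *: f t + g t) = a *: Phi f + Phi g,
        forall f, rnorm (Phi f) ^+ 2 =
          m%:R^-1 * \sum_(i < m) rnorm (f i) ^+ 2
      & forall e, exists f, Phi f = e].
Proof.
move=> cL2 BB_B.
have k0 : 0 <= m%:R^-1 :> R by rewrite invr_ge0.
pose k : {nonneg R} := NngNum k0.
pose mu : {measure set nat -> \bar R} :=
  mscale k (msum (fun i => \d_ i) m).
have mf (f : nat -> \bar R) : measurable_fun setT f by [].
have int_mu (f : nat -> R) : (forall i, 0 <= f i) ->
    (\int[mu]_t (f t)%:E)%E = (m%:R^-1 * \sum_(i < m) f i)%:E.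
  move=> f0; rewrite ge0_integral_mscale//; last by move=> x _; rewrite lee_fin.
  rewrite ge0_integral_measure_sum//; last by move=> x _; rewrite lee_fin.
  rewrite EFinM -sumEFin; congr (_ * _)%E; apply: eq_bigr => i _.
  by rewrite integral_dirac// diracE in_setT mul1e.
have int_rnorm (f : nat -> B) : (\int[mu]_t ((rnorm (f t)) ^+ 2)%:E)%E =
    (m%:R^-1 * \sum_(i < m) rnorm (f i) ^+ 2)%:E.
  by rewrite int_mu// => i; rewrite sqr_ge0.
have L2 (f : nat -> B) : L2_function mu f.
  split; last by rewrite int_rnorm ltry.
  (* The range of [f] may be infinite; cutting [f] off at n makes it finite, and at each t the
     sequence is constant for n > t. *)
  exists (fun n t => if (t < n)%N then f t else 0).
    move=> n; split => //.
    apply: (@sub_finite_set _ _ ((f @` `I_n) `|` [set 0])).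
      move=> _ [t _ <-]; case: ifP => tn; [left; exists t => //|by right].
    rewrite finite_setU; split; last exact: finite_set1.
    by apply: finite_image; exact: finite_II.
  move=> t; apply: cvg_near_cst; exists t.+1 => // n /= tn.
  by rewrite tn.
have [E BE [Phi [Pl Pn Ps]]] := cL2 _ _ mu B BB_B.
exists E; split => //; exists Phi; split.
- by move=> a f g; apply: Pl.
- by move=> f; have := Pn f (L2 f); rewrite int_rnorm => -[].
- by move=> e; have [f _ fe] := Ps e; exists f.
Qed.

End FiniteL2.

(** * Right translations of a box space *)

Section BoxGeometry.
Context {R : realType} (G : groupType) (N : nat -> set G).
Hypothesis HN : box_sequence N.
Local Open Scope group_scope.

Lemma box_N1 n : N n 1.
Proof. by case: HN => /(_ n)[]. Qed.

Lemma box_NV n g : N n g -> N n g^-1.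
Proof.
by case: HN => /(_ n)[N1 ND _ _] _ _ Ng; rewrite -[g^-1]mul1g; exact: ND.
Qed.

Lemma box_NM n g h : N n g -> N n h -> N n (g * h).
Proof.
by case: HN => /(_ n)[N1 ND _ _] _ _ Ng Nh; rewrite -(invgK h); apply/ND/box_NV.
Qed.

Lemma box_NJ n g h : N n h -> N n (g^-1 * h * g).
Proof.
by case: HN => /(_ n)[_ _ NJ _] _ _ /(NJ g); rewrite conjgE mulgA.
Qed.

Lemma box_N_sub n m : (n <= m)%N -> N m `<=` N n.
Proof.
case: HN => _ NS _; elim: m => [|m IH]; first by rewrite leqn0 => /eqP ->.
rewrite leq_eqVlt ltnS => /orP[/eqP <- //|/IH NN].
exact: subset_trans (NS m) NN.
Qed.

Definition level (x : box N) : nat := (val x).1.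

Definition box_mk (n : nat) (g : G) : box N :=
  exist _ (n, lcoset g (N n)) (asboolT (ex_intro _ g erefl)).

Definition box_rep (x : box N) : G := projT1 (cid (asboolW (valP x))).

Lemma box_mk_rep x : box_mk (level x) (box_rep x) = x.
Proof.
apply: val_inj => /=; rewrite /box_rep /level.
by case: cid => g /= <-; case: (val x).
Qed.

Lemma box_mkE n g h : (val (box_mk n g)).2 h <-> N n (g^-1 * h).
Proof.
split=> [[k Nk <-]|Nk]; first by rewrite mulKg.
by exists (g^-1 * h) => //; rewrite mulVKg.
Qed.

Lemma box_mk_eq n g h : box_mk n g = box_mk n h <-> N n (g^-1 * h).
Proof.
split=> [e|Ngh].
  by apply/box_mkE; rewrite e; apply/box_mkE; rewrite mulVg; exact: box_N1.
apply: val_inj => /=; congr (_, _); rewrite eqEsubset; split=> _ [k Nk <-].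
  exists ((g^-1 * h)^-1 * k); first exact/box_NM/Nk/box_NV.
  by rewrite invgM invgK -!mulgA !mulVKg.
exists (g^-1 * h * k); first exact: box_NM.
by rewrite -mulgA mulVKg.
Qed.

Definition box_tr (x : box N) (a : G) : box N :=
  box_mk (level x) (box_rep x * a).

(** [box_tr] is defined through a chosen representative; normality of N_n makes the result
    independent of it. *)
Lemma box_tr_mk n g a : box_tr (box_mk n g) a = box_mk n (g * a).
Proof.
have : box_mk n (box_rep (box_mk n g)) = box_mk n g.
  exact: (box_mk_rep (box_mk n g)).
rewrite /box_tr /= => /box_mk_eq Ng; apply/box_mk_eq.
by rewrite invgM -mulgA (mulgA _ g) mulgA; exact: box_NJ.
Qed.

Lemma level_tr x a : level (box_tr x a) = level x.
Proof. by []. Qed.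

Lemma box_tr1 x : box_tr x 1 = x.
Proof. by rewrite /box_tr mulg1 box_mk_rep. Qed.

Lemma box_trM x a b : box_tr (box_tr x a) b = box_tr x (a * b).
Proof. by rewrite {2}/box_tr box_tr_mk /box_tr mulgA. Qed.

Lemma box_trK a : cancel (box_tr^~ a) (box_tr^~ a^-1).
Proof. by move=> x; rewrite box_trM mulgV box_tr1. Qed.

Lemma box_trKV a : cancel (box_tr^~ a^-1) (box_tr^~ a).
Proof. by move=> x; rewrite box_trM mulVg box_tr1. Qed.

(** The ambiguity of the translator between two points of level n is exactly N_n, whatever the
    starting point. *)
Lemma box_tr_eq x a b : box_tr x a = box_tr x b <-> N (level x) (a^-1 * b).
Proof.
rewrite /box_tr; apply: (iff_trans (box_mk_eq _ _ _)).
by rewrite invgM -mulgA mulKg.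
Qed.

Lemma box_tr_trans x y : level x = level y -> exists a, y = box_tr x a.
Proof.
move=> xy; exists ((box_rep x)^-1 * box_rep y).
by rewrite /box_tr mulVKg xy box_mk_rep.
Qed.

Lemma box_elt_tr x y g h : level x = level y ->
  (val x).2 g -> (val y).2 h -> y = box_tr x (g^-1 * h).
Proof.
move=> xy; rewrite -(box_mk_rep x) -(box_mk_rep y) xy => /box_mkE xg /box_mkE yh.
have -> : box_mk (level y) (box_rep x) = box_mk (level y) g by exact/box_mk_eq.
by rewrite box_tr_mk mulVKg; exact/box_mk_eq.
Qed.

Section Distance.
Local Open Scope ring_scope.
Variable l : G -> R.

Lemma box_dist_tr x a : (box_dist l x (box_tr x a) <= (l a)%:E)%E.
Proof.
rewrite /box_dist eqxx; apply: ereal_inf_lbound.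
exists (box_rep x), (box_rep x * a)%g; split.
- rewrite -[X in (val X).2]box_mk_rep; apply/box_mkE.
  by rewrite mulVg; exact: box_N1.
- by apply/box_mkE; rewrite mulVg; exact: box_N1.
- by rewrite mulKg.
Qed.

Lemma box_dist_level x y r : (box_dist l x y <= r%:E)%E -> level x = level y.
Proof. by rewrite /box_dist; case: ifP => [/eqP//|_]. Qed.

(** The inequality is strict because the distance is an infimum over translators, which for a
    general length need not be attained. *)
Lemma box_dist_lt x y r : (box_dist l x y < r%:E)%E ->
  exists2 a, y = box_tr x a & l a < r.
Proof.
move=> xyr; have xy := box_dist_level (ltW xyr).
move: xyr; rewrite /box_dist; move: (xy); rewrite /level => ->; rewrite eqxx.
move=> /ereal_inf_lt[_ [g [h [xg yh ->]]]]; rewrite lte_fin => lr.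
by exists (g^-1 * h)%g => //; exact: box_elt_tr.
Qed.

Lemma box_dist_ge x y (L : \bar R) :
  (forall a, box_tr x a = y -> (L <= (l a)%:E)%E) ->
  (L <= box_dist l x y)%E.
Proof.
move=> Ll; rewrite /box_dist; case: ifP => [/eqP xy|_]; last by rewrite leey.
apply: le_ereal_inf_tmp => _ [g [h [xg yh ->]]]; apply: Ll.
by apply/esym/box_elt_tr.
Qed.

End Distance.

End BoxGeometry.

(** * Finite pieces, and translators of almost minimal length *)

Section BoxPieces.
Context {R : realType} (G : groupType) (N : nat -> set G).
Hypothesis HN : box_sequence N.

Lemma finite_level n : finite_set [set x : box N | level x = n].
Proof.
case: (HN) => /(_ n)[_ _ _ fN] _ _.
apply: (sub_finite_set _ (finite_image (fun C => box_mk N n (xget 1%g C)) fN)).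
move=> x /= xn; exists (lcoset (box_rep x) (N n)); first by exists (box_rep x).
have := box_mk_rep x; rewrite xn => {2}<-.
apply/box_mk_eq => //; rewrite -[(_ * _)%g]invgK; apply: box_NV => //.
rewrite invgM invgK.
have : lcoset (box_rep x) (N n) (xget 1%g (lcoset (box_rep x) (N n))).
  apply: (@xgetPex _ 1%g); exists (box_rep x * 1)%g; exists 1%g => //.
  exact: box_N1.
by case=> h Nh <-; rewrite mulKg.
Qed.

Definition piece (n : nat) : seq (box N) :=
  finmap.enum_fset (fset_set [set x : box N | level x = n]).

Lemma mem_piece n x : (x \in piece n) = (level x == n).
Proof.
rewrite /piece in_fset_set; last exact: finite_level.
by apply/idP/eqP; rewrite inE.
Qed.

Lemma piece_uniq n : uniq (piece n).
Proof. exact: finmap.fset_uniq. Qed.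

Lemma size_piece_gt0 n : (0 < size (piece n))%N.
Proof.
have : box_mk N n 1%g \in piece n by rewrite mem_piece.
by case: (piece n).
Qed.

Lemma sum_piece_tr (V : nmodType) n a (F : box N -> V) :
  \sum_(x <- piece n) F (box_tr x a) = \sum_(x <- piece n) F x.
Proof.
rewrite -(big_map (fun x => box_tr x a) xpredT F); apply: perm_big; apply: uniq_perm.
- by rewrite map_inj_uniq ?piece_uniq//; exact: (can_inj (box_trK HN a)).
- exact: piece_uniq.
move=> x; rewrite mem_piece; apply/mapP/idP => [[y + ->]|xn].
  by rewrite mem_piece level_tr.
by exists (box_tr x a^-1%g); rewrite ?box_trKV// mem_piece level_tr.
Qed.

Lemma sum_piece_indic (V : nmodType) x a (F : box N -> V) :
  \sum_(y <- piece (level x) | y == box_tr x a) F y = F (box_tr x a).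
Proof.
rewrite -big_filter filter_pred1_uniq ?piece_uniq ?big_seq1//.
by rewrite mem_piece level_tr.
Qed.

Section ProperLength.
Variable l : G -> R.
Hypothesis Hl : proper_length_function l.

(** The ball is finite, and each of its nontrivial elements leaves the nested sequence at some level
    because the intersection is trivial; the largest of these levels serves as [n0]. *)
Lemma proper_length_separated (r : R) : exists n0, forall n, (n0 <= n)%N ->
  forall h, N n h -> l h <= r -> h = 1%g.
Proof.
case: (Hl) => _ _ /(_ r) /finite_seqP[s sE].
have [n0 hn0] : exists n0, forall n, (n0 <= n)%N ->
    forall h, h \in s -> N n h -> h = 1%g.
  elim: s {sE} => [|g s [n0 IH]]; first by exists 0%N.
  have [g1|g1] := eqVneq g 1%g.
    exists n0 => n n0n h; rewrite inE => /orP[/eqP -> //|hs].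
    exact: (IH _ n0n).
  have [k Ngk] : exists k, ~ N k g.
    apply/existsNP => Ng; case: (HN) => _ _ N1.
    have : (\bigcap_n N n) g by move=> k _.
    by rewrite N1 /= => /eqP; rewrite (negbTE g1).
  exists (maxn n0 k) => n; rewrite geq_max => /andP[n0n kn] h.
  rewrite inE => /orP[/eqP ->|hs]; last exact: (IH _ n0n).
  by move=> /(box_N_sub HN kn).
exists n0 => n n0n h Nh hr; apply: (hn0 n) => //.
by have : [set g | l g <= r] h by []; rewrite sE.
Qed.

Definition length_ball (r : R) : seq G :=
  finmap.enum_fset (fset_set [set g | l g <= r]).

Lemma mem_length_ball r g : (g \in length_ball r) = (l g <= r).
Proof.
rewrite /length_ball in_fset_set; last by case: Hl.
by apply/idP/idP; rewrite inE.
Qed.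

Lemma length_ball_uniq r : uniq (length_ball r).
Proof. exact: finmap.fset_uniq. Qed.

(** The slack 1 guarantees a candidate without discussing whether the infimum is attained. The
    default 1 is returned only when x and y lie on different levels. *)
Definition near_translator (x y : box N) : G :=
  xget 1%g [set a | y = box_tr x a /\
                    ((l a)%:E <= box_dist l x y + 1%:E)%E].

Lemma near_translatorP x y : level x = level y ->
  y = box_tr x (near_translator x y) /\
  ((l (near_translator x y))%:E <= box_dist l x y + 1%:E)%E.
Proof.
move=> /(box_tr_trans)[b yb]; rewrite /near_translator.
apply: (@xgetPex _ 1%g [set a | y = box_tr x a /\
                    ((l a)%:E <= box_dist l x y + 1%:E)%E]).
have d0 : (0 <= box_dist l x y)%E.
  apply: box_dist_ge => // a _; rewrite lee_fin.
  by case: (Hl) => -[].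
have dfin : box_dist l x y \is a fin_num.
  by rewrite ge0_fin_numE// yb (le_lt_trans (box_dist_tr HN l x b))// ltry.
have [|a ya la] := @box_dist_lt R G N HN l x y (fine (box_dist l x y) + 1).
  by rewrite -[ltLHS]fineK// lte_fin ltrDl.
by exists a; split => //; rewrite -[X in (X + _)%E]fineK// -EFinD lee_fin ltW.
Qed.

Lemma box_tr_near_translator x y : level x = level y ->
  box_tr x (near_translator x y) = y.
Proof. by move=> /near_translatorP[]. Qed.

Lemma near_translator_le x y r : (box_dist l x y <= r%:E)%E ->
  l (near_translator x y) <= r + 1.
Proof.
move=> xyr; have [_] := near_translatorP (box_dist_level xyr).
by move=> /le_trans; rewrite -lee_fin; apply; rewrite EFinD leeD2r.
Qed.

End ProperLength.

(** On the finite [l]-ball, [l'] is bounded by some K. A translator b with the same effect as a and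
    smaller [l'] would give a^-1 b in N_n of [l']-length at most 2K, hence b = a on deep levels. *)
Lemma box_dist_eventually_ge (l l' : G -> R) (r : R) :
  proper_length_function l -> proper_length_function l' ->
  exists n0, forall (x : box N) a, (n0 <= level x)%N -> l a <= r ->
    ((l' a)%:E <= box_dist l' x (box_tr x a))%E.
Proof.
move=> Hl Hl'; have [[_ l'0 l'V l'M] _ _] := Hl'.
have [K HK] : exists K, forall a, l a <= r -> l' a <= K.
  exists (\sum_(b <- length_ball l r) l' b) => a.
  rewrite -(mem_length_ball Hl) => ar.
  by rewrite (big_rem a)//= lerDl sumr_ge0.
have [n0 Hn0] := proper_length_separated Hl' (K + K).
exists n0 => x a n0x /HK aK; apply: box_dist_ge => // b xb; rewrite lee_fin.
have [//|ba] := leP (l' a) (l' b).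
suff ba' : b = a by rewrite ba' ltxx in ba.
have Nab : N (level x) (a^-1 * b)%g by apply/(box_tr_eq HN).
have : (a^-1 * b = 1)%g.
  apply: (Hn0 (level x)) => //.
  by apply: (le_trans (l'M _ _)); rewrite l'V lerD// (le_trans (ltW ba)).
by move/(congr1 (fun g => a * g)%g); rewrite mulVKg mulg1.
Qed.

End BoxPieces.

(** * The ultraproduct of the L2 spaces of the finite quotients *)

Section BoxModel.
Context {R : realType} (G : groupType) (N : nat -> set G).
Hypothesis HN : box_sequence N.

Definition piece_avg (n : nat) (f : box N -> R) : R :=
  (size (piece N n))%:R^-1 * \sum_(x <- piece N n) f x.

Lemma piece_avg_ge0 n f : (forall x, 0 <= f x) -> 0 <= piece_avg n f.
Proof. by move=> f0; rewrite mulr_ge0 ?invr_ge0// sumr_ge0. Qed.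

Lemma le_piece_avg n f g : (forall x, level x = n -> f x <= g x) ->
  piece_avg n f <= piece_avg n g.
Proof.
move=> fg; rewrite ler_wpM2l ?invr_ge0// big_seq [leRHS]big_seq.
by apply: ler_sum => x; rewrite mem_piece// => /eqP; exact: fg.
Qed.

Lemma piece_avg_cst n c : piece_avg n (fun=> c) = c.
Proof.
rewrite /piece_avg big_const_seq count_predT iter_addr_0 -[c *+ _]mulr_natl mulrA.
by rewrite mulVf ?mul1r// pnatr_eq0 -lt0n size_piece_gt0.
Qed.

Lemma piece_avgD n f g :
  piece_avg n (fun x => f x + g x) = piece_avg n f + piece_avg n g.
Proof. by rewrite /piece_avg big_split mulrDr. Qed.

Lemma piece_avgZ n c f : piece_avg n (fun x => c * f x) = c * piece_avg n f.
Proof. by rewrite /piece_avg -mulr_sumr mulrCA. Qed.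

Lemma piece_avg_sum n (I : Type) (s : seq I) (f : I -> box N -> R) :
  piece_avg n (fun x => \sum_(i <- s) f i x) = \sum_(i <- s) piece_avg n (f i).
Proof. by rewrite /piece_avg exchange_big/= mulr_sumr. Qed.

Lemma piece_avg_tr n a f : piece_avg n (fun x => f (box_tr x a)) = piece_avg n f.
Proof. by rewrite /piece_avg (sum_piece_tr HN n a f). Qed.

Section Norm.
Variable B : Banach R.
Implicit Types F : box N -> B.

Definition sqr_norm n F : R := piece_avg n (fun x => rnorm (F x) ^+ 2).

Definition l2_norm n F : R := Num.sqrt (sqr_norm n F).

Definition l2_bounded F : Prop := exists M : R, forall n, sqr_norm n F <= M.

Lemma sqr_norm_ge0 n F : 0 <= sqr_norm n F.
Proof. by apply: piece_avg_ge0 => x; rewrite sqr_ge0. Qed.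

Lemma l2_norm_le n F M : 0 <= M -> (l2_norm n F <= M) = (sqr_norm n F <= M ^+ 2).
Proof.
move=> M0; rewrite /l2_norm -[M in LHS]ger0_norm// -sqrtr_sqr ler_sqrt//.
by rewrite sqr_ge0.
Qed.

Lemma sqr_sqr_norm n F : l2_norm n F ^+ 2 = sqr_norm n F.
Proof. by rewrite /l2_norm sqr_sqrtr// sqr_norm_ge0. Qed.

Lemma l2_bounded_lin a F F' : l2_bounded F -> l2_bounded F' ->
  l2_bounded (fun x => a *: F x + F' x).
Proof.
move=> [M FM] [M' FM']; exists (2 * (cabs a ^+ 2 * M) + 2 * M') => n.
apply: (@le_trans _ _ (2 * (cabs a ^+ 2 * sqr_norm n F) + 2 * sqr_norm n F')).
  rewrite /sqr_norm -!piece_avgZ -piece_avgD; apply: le_piece_avg => x _.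
  apply: (@le_trans _ _ ((cabs a * rnorm (F x) + rnorm (F' x)) ^+ 2)).
    rewrite ler_sqr ?nnegrE ?addr_ge0 ?mulr_ge0 ?rnorm_ge0 ?cabs_ge0//.
    by rewrite -rnormZ rnormD.
  rewrite -exprMn; set u := _ * _; set v := rnorm _.
  rewrite -subr_ge0 [leRHS](_ : _ = (u - v) ^+ 2) ?sqr_ge0//.
  by rewrite sqrrD sqrrB; ring.
by rewrite lerD// ler_wpM2l// ler_wpM2l// ?sqr_ge0.
Qed.

Lemma l2_bounded_cst (v : B) : l2_bounded (fun=> v).
Proof. by exists (rnorm v ^+ 2) => n; rewrite /sqr_norm piece_avg_cst. Qed.

End Norm.

(** The pieces are disjoint, so a sequence of functions on them is a single function on the box
    space; elements of the ultraproduct are thus represented by l2-bounded functions. *)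
Lemma box_ultraproduct_model (w : set_system nat) (BB : Banach R -> Prop)
    (B : Banach R) : UltraFilter w -> nonprincipal w ->
  closed_ultraproducts BB -> closed_L2 BB -> BB B ->
  exists E : Banach R, BB E /\ exists Theta : (box N -> B) -> E,
    [/\ forall a F F', l2_bounded F -> l2_bounded F' ->
          Theta (fun x => a *: F x + F' x) = a *: Theta F + Theta F',
        forall F, l2_bounded F -> forall e : R, 0 < e ->
          w [set n | `|l2_norm n F - rnorm (Theta F)| < e]
      & forall v, exists2 F, l2_bounded F & Theta F = v].
Proof.
move=> wU wn cU cL BB_B.
pose H n := cid (finite_L2_model (size (piece N n)) cL BB_B).
pose E n : Banach R := projT1 (H n).
have BE n : BB (E n) by case: (projT2 (H n)).
have Phi_ex n : {Phi : (nat -> B) -> E n |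
    [/\ forall a f g, Phi (fun t => a *: f t + g t) = a *: Phi f + Phi g,
      forall f, rnorm (Phi f) ^+ 2 = (size (piece N n))%:R^-1 *
        \sum_(i < size (piece N n)) rnorm (f i) ^+ 2
      & forall e, exists f, Phi f = e]}.
  by apply: cid; case: (projT2 (H n)).
pose Phi n : (nat -> B) -> E n := projT1 (Phi_ex n).
have Phil n a f g : Phi n (fun t => a *: f t + g t) = a *: Phi n f + Phi n g.
  by case: (projT2 (Phi_ex n)) => Hl _ _; exact: Hl.
have Phin n f : rnorm (Phi n f) ^+ 2 =
    (size (piece N n))%:R^-1 * \sum_(i < size (piece N n)) rnorm (f i) ^+ 2.
  by case: (projT2 (Phi_ex n)) => _ Hn _; exact: Hn.
have Phis n e : exists f, Phi n f = e.
  by case: (projT2 (Phi_ex n)) => _ _ Hs; exact: Hs.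
(* The norm of [Phi n f] sees only the indices below the size of the piece, so the other values are
   irrelevant. *)
have Phi_ext n f g : (forall i, (i < size (piece N n))%N -> f i = g i) ->
    Phi n f = Phi n g.
  move=> fg; apply/eqP; rewrite -subr_eq0; apply/eqP/rnorm_eq0.
  apply/eqP; rewrite -sqrf_eq0 -scaleN1r addrC -Phil Phin big1 ?mulr0// => i _.
  by rewrite fg// scaleN1r addNr rnorm0 expr0n.
have [F0 BF [Psi [Psil Psin Psis]]] := cU w E wU wn BE.
pose fam (F : box N -> B) n : E n :=
  Phi n (fun i => F (nth (box_mk N n 1%g) (piece N n) i)).
have famn n F : rnorm (fam F n) = l2_norm n F.
  apply/eqP; rewrite -(eqrXn2 (n:=2))// ?rnorm_ge0 ?sqrtr_ge0// sqr_sqr_norm.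
  rewrite Phin /sqr_norm /piece_avg.
  by rewrite (big_nth (box_mk N n 1%g)) big_mkord.
have fam_bounded F : l2_bounded F -> bounded_family (fam F).
  move=> [M FM]; exists (Num.sqrt M) => n; rewrite famn.
  by rewrite /l2_norm ler_wsqrtr.
exists F0; split => //; exists (fun F => Psi (fam F)); split.
- move=> a F F' bF bF'; rewrite -Psil; [|exact: fam_bounded|exact: fam_bounded].
  by congr Psi; apply: functional_extensionality_dep => n; rewrite -Phil.
- move=> F bF e e0.
  have /cvgrPdist_lt/(_ e e0) := Psin _ (fam_bounded F bF).
  apply: filterS => n /=; rewrite famn distrC.
  by [].
move=> v; have [xi [M xiM] <-] := Psis v.
pose f n : nat -> B := projT1 (cid (Phis n (xi n))).
have fE n : Phi n (f n) = xi n by exact: projT2 (cid (Phis n (xi n))).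
(* [index] inverts the enumeration of the piece used in [fam]. *)
pose F (x : box N) : B := f (level x) (index x (piece N (level x))).
have famF : fam F = xi.
  apply: functional_extensionality_dep => n; rewrite -fE; apply: Phi_ext => i iN.
  have : nth (box_mk N n 1%g) (piece N n) i \in piece N n by exact: mem_nth.
  rewrite mem_piece// => /eqP xn.
  by rewrite /F xn index_uniq// piece_uniq.
exists F; last by rewrite famF.
exists (M ^+ 2) => n; rewrite -l2_norm_le ?(le_trans (rnorm_ge0 _) (xiM 0%N))//.
by rewrite -famn famF.
Qed.

End BoxModel.

(** * From representations of the group to the box space *)

Section BoxOperators.
Context {R : realType} (G : groupType) (N : nat -> set G).
Hypothesis HN : box_sequence N.
Variable l : G -> R.
Hypothesis Hl : proper_length_function l.
Local Notation nt := (near_translator l).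

Lemma fsbig_level (V : nmodType) n (f : box N -> V) :
  (forall y, f y != 0 -> level y = n) ->
  \sum_(y \in [set: box N]) f y = \sum_(y <- piece N n) f y.
Proof.
move=> fn; rewrite -(fsbig_widen [set x : box N | level x = n])//.
  by rewrite fsbig_finite//; exact: finite_level.
move=> y [_ /= yn]; apply/eqP/negP => /negP fy.
by apply: yn; exact: fn.
Qed.

(** The chosen translator has length at most r + 1 and a has length at most r. They differ by an
    element of N_n, of length at most r + (r + 1), which is trivial on deep levels. *)
Lemma near_translator_tr (r : R) : exists n0, forall (x : box N) a,
  (n0 <= level x)%N -> l a <= r -> nt x (box_tr x a) = a.
Proof.
have [n0 Hn0] := proper_length_separated HN Hl (r + (r + 1)).
have [[_ l0 lV lM] _ _] := Hl.
exists n0 => x a n0x ar.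
have /(box_tr_eq HN) Na : box_tr x a = box_tr x (nt x (box_tr x a)).
  by rewrite box_tr_near_translator.
have : (a^-1 * nt x (box_tr x a) = 1)%g.
  apply: (Hn0 _ n0x _ Na); apply: (le_trans (lM _ _)).
  rewrite lV lerD// near_translator_le// (le_trans (box_dist_tr HN l x a))//.
by move/(congr1 (fun g => a * g)%g); rewrite mulVKg mulg1.
Qed.

Lemma Cu_bounds T : Cu (box_dist l) T -> exists M r : R,
  [/\ 0 <= M, forall x y : box N, cabs (T x y) <= M
    & forall x y : box N, T x y != 0 ->
        level x = level y /\ l (nt x y) <= r].
Proof.
move=> [[M TM] [r Tr]]; exists M, (r + 1).
have TM' x y : cabs (T x y) <= M by rewrite -lecR -normr_cabs.
split => //.
  by apply: (le_trans (cabs_ge0 _) (TM' (box_mk N 0 1%g) (box_mk N 0 1%g))).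
move=> x y Txy; have xy := Tr x y Txy.
by split; [exact: box_dist_level xy|exact: near_translator_le].
Qed.

(** A Cauchy-Schwarz inequality with a crude constant; what matters is that it does not depend on
    [a]. *)
Lemma sqr_sum_le (I : Type) (s : seq I) : exists2 C : R, 0 <= C &
  forall a : I -> R,
    (\sum_(i <- s) a i) ^+ 2 <= C * \sum_(i <- s) a i ^+ 2.
Proof.
elim: s => [|i s [C C0 IH]].
  by exists 0 => // a; rewrite !big_nil expr0n mulr0.
exists (2 + 2 * C) => [|a]; first by rewrite addr_ge0// mulr_ge0.
rewrite !big_cons; move: (IH a).
have : 0 <= \sum_(j <- s) a j ^+ 2 by apply: sumr_ge0 => j _; rewrite sqr_ge0.
move: (\sum_(j <- s) a j) (\sum_(j <- s) a j ^+ 2) => u v v0 uv.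
have H := sqr_ge0 (a i - u); have H2 := mulr_ge0 C0 (sqr_ge0 (a i)).
by rewrite sqrrB in H; rewrite sqrrD; nra.
Qed.

Lemma big_unique (V : nmodType) (I : eqType) (s : seq I) (P : pred I) i
    (F : I -> V) : uniq s -> i \in s -> P i -> (forall j, P j -> j = i) ->
  \sum_(j <- s | P j) F j = F i.
Proof.
move=> us si Pi P1; rewrite (eq_bigl (pred1 i)) => [|j].
  by rewrite -big_filter filter_pred1_uniq ?big_seq1.
by apply/idP/eqP => [/P1 //|->].
Qed.

Lemma sum_at_most_one (I : eqType) (s : seq I) (P : pred I) (a : I -> R) b :
  uniq s -> 0 <= b -> (forall i j, P i -> P j -> i = j) ->
  (forall i, P i -> a i <= b) -> \sum_(i <- s | P i) a i <= b.
Proof.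
move=> us b0 P1 ab; have [/hasP[i si Pi]|/hasPn sP] := boolP (has P s).
  by rewrite (big_unique _ us si)// ?ab// => j /P1; exact.
by rewrite big_seq_cond big1// => i /andP[/sP/negbTE ->].
Qed.

Variable B : Banach R.
Variable pi : G -> B -> B.
Hypothesis Hpi : group_rep pi.
Variable K : G -> R.
Hypothesis K0 : forall g, 0 <= K g.
Hypothesis HK : forall g x, rnorm (pi g x) <= K g * rnorm x.
Implicit Types (F : box N -> B).

Lemma group_rep_linear g : linear (pi g).
Proof. by case: Hpi => /(_ g)[]. Qed.

(* With T written as a finite sum of f_g V_g, where V_g is translation by g and
   f_g is diagonal, this is the sum of the operators f_g V_g (x) pi(g); the
   expression is unique on deep enough levels. *)
Definition twist (T : box N -> box N -> R[i]) F : box N -> B :=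
  fun x => \sum_(y <- piece N (level x)) T x y *: pi (nt x y) (F y).

Lemma twist_linear T a F F' :
  twist T (fun x => a *: F x + F' x) = (fun x => a *: twist T F x + twist T F' x).
Proof.
apply/funext => x; rewrite /twist scaler_sumr -big_split; apply: eq_bigr => y _.
by rewrite group_rep_linear scalerDr !scalerA mulrC.
Qed.

Lemma twist_linear_mx a T T' F :
  twist (fun x y => a * T x y + T' x y) F =
  (fun x => a *: twist T F x + twist T' F x).
Proof.
apply/funext => x; rewrite /twist scaler_sumr -big_split; apply: eq_bigr => y _.
by rewrite scalerDl scalerA.
Qed.

(** The constant is the same on all levels: the translators that occur lie in one finite ball, so
    |TF(x)| is dominated by a fixed finite combination of the |F(xg)|, and averages are invariant
    under x -> xg. *)
Lemma twist_bound T : Cu (box_dist l) T -> exists2 C : R, 0 <= C &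
  forall F n, sqr_norm n (twist T F) <= C ^+ 2 * sqr_norm n F.
Proof.
move=> /Cu_bounds[M [r [M0 TM Tr]]].
pose L := length_ball l r.
have [C C0 HC] := sqr_sum_le L.
have D0 : 0 <= \sum_(g <- L) (M * K g) ^+ 2.
  by apply: sumr_ge0 => g _; rewrite sqr_ge0.
exists (Num.sqrt (C * \sum_(g <- L) (M * K g) ^+ 2)) => [|F n].
  exact: sqrtr_ge0.
rewrite sqr_sqrtr; last exact: mulr_ge0.
have ptw x : rnorm (twist T F x) <=
    \sum_(g <- L) M * K g * rnorm (F (box_tr x g)).
  apply: (@le_trans _ _ (\sum_(y <- piece N (level x)) \sum_(g <- L)
      if y == box_tr x g then M * K g * rnorm (F y) else 0)); last first.
    rewrite exchange_big/=; apply: ler_sum => g _.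
    by rewrite -big_mkcond (sum_piece_indic HN x g (fun y => M * K g * rnorm (F y))).
  apply: (le_trans (rnorm_sum _ _ _)); apply: ler_sum => y _.
  have pos g : 0 <= if y == box_tr x g then M * K g * rnorm (F y) else 0.
    by case: ifP => // _; rewrite !mulr_ge0 ?rnorm_ge0.
  have [->|Txy] := eqVneq (T x y) 0.
    by rewrite scale0r rnorm0 sumr_ge0.
  have [xy lr] := Tr x y Txy.
  have /(big_rem (nt x y)) -> : nt x y \in L by rewrite mem_length_ball.
  rewrite /= box_tr_near_translator// eqxx -[leLHS]addr0 lerD ?sumr_ge0//.
  rewrite rnormZ -mulrA ler_pM ?cabs_ge0 ?rnorm_ge0//; exact: HK.
rewrite /sqr_norm -piece_avgZ.
apply: (@le_trans _ _ (piece_avg n (fun x =>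
   C * \sum_(g <- L) (M * K g) ^+ 2 * rnorm (F (box_tr x g)) ^+ 2))).
  apply: le_piece_avg => // x _.
  apply: (@le_trans _ _ ((\sum_(g <- L) M * K g * rnorm (F (box_tr x g))) ^+ 2)).
    rewrite ler_sqr ?nnegrE ?rnorm_ge0//; apply: sumr_ge0 => g _.
    by rewrite !mulr_ge0 ?rnorm_ge0.
  by apply: (le_trans (HC _)); under eq_bigr do rewrite exprMn.
rewrite !piece_avgZ piece_avg_sum -mulrA ler_wpM2l// mulr_suml ler_sum// => g _.
by rewrite piece_avgZ (piece_avg_tr HN n g (fun x => rnorm (F x) ^+ 2)).
Qed.

Lemma twist_l2_bounded T F :
  Cu (box_dist l) T -> l2_bounded F -> l2_bounded (twist T F).
Proof.
move=> /twist_bound[C C0 HC] [M FM]; exists (C ^+ 2 * M) => n.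
by apply: (le_trans (HC _ _)); rewrite ler_wpM2l ?sqr_ge0.
Qed.

(** Each row and each column of [V] has at most one nonzero entry, so the squares rearrange without
    the Cauchy-Schwarz loss of [twist_bound]. This keeps the growth constant c unchanged. *)
Lemma twist_growth V (n0 : nat) (c : R) : partial_translation (box_dist l) V ->
  0 <= c ->
  (forall x y, (n0 <= level x)%N -> V x y != 0 -> K (nt x y) <= c) ->
  forall F n, (n0 <= n)%N -> sqr_norm n (twist V F) <= c ^+ 2 * sqr_norm n F.
Proof.
move=> [VC V01 Vr Vc] c0 Kc F n n0n.
rewrite /sqr_norm /piece_avg mulrCA ler_wpM2l ?invr_ge0//.
apply: (@le_trans _ _ (\sum_(x <- piece N n) \sum_(y <- piece N n | V x y != 0)
    c ^+ 2 * rnorm (F y) ^+ 2)).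
  rewrite big_seq [leRHS]big_seq; apply: ler_sum => x.
  rewrite mem_piece// => /eqP xn.
  have [/hasP[y yn Vxy]|/hasPn Vx] := boolP (has (fun y => V x y != 0) (piece N n)).
    rewrite (big_unique _ (piece_uniq _ _) yn Vxy); last first.
      by move=> z Vxz; exact: Vr Vxz Vxy.
    have V1 : V x y = 1 by case: (V01 x y) Vxy => -> //; rewrite eqxx.
    rewrite /twist xn (bigD1_seq y) ?piece_uniq//= big1 ?addr0; last first.
      move=> z /eqP zy; have [->|Vxz] := eqVneq (V x z) 0; first by rewrite scale0r.
      by case: zy; exact: Vr Vxz Vxy.
    rewrite V1 scale1r -exprMn ler_sqr ?nnegrE ?mulr_ge0 ?rnorm_ge0//.
    apply: (le_trans (HK _ _)); rewrite ler_wpM2r ?rnorm_ge0//.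
    by apply: Kc; rewrite ?xn.
  rewrite /twist xn [X in rnorm X]big_seq big1; last first.
    by move=> y /Vx; rewrite negbK => /eqP ->; rewrite scale0r.
  by rewrite rnorm0 expr0n sumr_ge0// => y _; rewrite mulr_ge0 ?sqr_ge0.
under eq_bigr do rewrite big_mkcond.
rewrite exchange_big mulr_sumr; apply: ler_sum => y _.
rewrite -big_mkcond; apply: sum_at_most_one => //.
- exact: piece_uniq.
- by rewrite mulr_ge0 ?sqr_ge0.
- by move=> x x'; exact: Vc.
Qed.

(** On deep levels translators multiply: nt x y * nt y z leads from x to z and has length at most r
    + r', so it is the chosen translator from x to z. *)
Lemma twist_mul T T' F : Cu (box_dist l) T -> Cu (box_dist l) T' ->
  exists n0, forall x, (n0 <= level x)%N ->
    twist (mx_mul T T') F x = twist T (twist T' F) x.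
Proof.
move=> /Cu_bounds[M [r [_ _ Tr]]] /Cu_bounds[M' [r' [_ _ Tr']]].
have [[_ _ _ lM] _ _] := Hl.
have [n0 Hn0] := near_translator_tr (r + r').
exists n0 => x n0x; rewrite /twist.
have -> : \sum_(z <- piece N (level x)) mx_mul T T' x z *: pi (nt x z) (F z) =
    \sum_(z <- piece N (level x)) \sum_(y <- piece N (level x))
      (T x y * T' y z) *: pi (nt x z) (F z).
  apply: eq_bigr => z _; rewrite /mx_mul (@fsbig_level _ (level x)).
    by rewrite scaler_suml.
  by move=> y; rewrite mulf_eq0 negb_or => /andP[/Tr[]].
rewrite exchange_big/= big_seq [RHS]big_seq; apply: eq_bigr => y.
rewrite mem_piece// => /eqP ->.
rewrite (linear_prop_sum (group_rep_linear _)) scaler_sumr; apply: eq_bigr => z _.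
rewrite (linear_propZ (group_rep_linear _)) scalerA.
have [->|Txy] := eqVneq (T x y) 0; first by rewrite mul0r !scale0r.
have [->|Tyz] := eqVneq (T' y z) 0; first by rewrite mulr0 !scale0r.
have [xy lr] := Tr _ _ Txy; have [yz lr'] := Tr' _ _ Tyz.
congr (_ *: _).
have -> : nt x z = (nt x y * nt y z)%g.
  rewrite -[in nt x z](box_tr_near_translator HN Hl yz).
  rewrite -[in box_tr y _](box_tr_near_translator HN Hl xy) box_trM//.
  rewrite box_tr_near_translator// Hn0//.
  by rewrite (le_trans (lM _ _))// lerD.
by case: Hpi => _ _ ->.
Qed.

Lemma twist_tr (a : G) : exists n0, forall F x, (n0 <= level x)%N ->
  twist (fun x y => (y == box_tr x a)%:R) F x = pi a (F (box_tr x a)).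
Proof.
have [n0 Hn0] := near_translator_tr (l a).
exists n0 => F x n0x; rewrite /twist (bigD1_seq (box_tr x a)) ?piece_uniq//=.
  rewrite eqxx scale1r Hn0// big1 ?addr0// => y /negbTE ->.
  by rewrite scale0r.
by rewrite mem_piece.
Qed.

End BoxOperators.

(** * The representation of the matrices on the ultraproduct *)

Section UltraproductRepresentation.
Context {R : realType} (G : groupType) (N : nat -> set G).
Hypothesis HN : box_sequence N.
Variables l l' : G -> R.
Hypotheses (Hl : proper_length_function l) (Hl' : proper_length_function l').
Variables (w : set_system nat) (wU : UltraFilter w) (wn : nonprincipal w).
Variables (B E : Banach R) (Theta : (box N -> B) -> E).
Hypothesis ThetaL : forall a F F', l2_bounded F -> l2_bounded F' ->
  Theta (fun x => a *: F x + F' x) = a *: Theta F + Theta F'.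
Hypothesis ThetaN : forall F, l2_bounded F -> forall e : R, 0 < e ->
  w [set n | `|l2_norm n F - rnorm (Theta F)| < e].
Hypothesis ThetaS : forall v, exists2 F, l2_bounded F & Theta F = v.
Local Notation nt := (near_translator l).

Lemma Theta_le F F' (c : R) n0 : l2_bounded F -> l2_bounded F' -> 0 <= c ->
  (forall n, (n0 <= n)%N -> sqr_norm n F <= c ^+ 2 * sqr_norm n F') ->
  rnorm (Theta F) <= c * rnorm (Theta F').
Proof.
move=> bF bF' c0 FF; apply/ler_addgt0Pr => e e0.
have c1 : 0 < c + 1 by rewrite ltr_wpDl.
(* The error for [F] counts once and the error for [F'] is multiplied by c. *)
have e1 : 0 < e / (c + 1) by rewrite divr_gt0.
have [n [[/= Fn F'n] n0n]] := filter_ex (filterI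
  (filterI (ThetaN bF e1) (ThetaN bF' e1)) (nonprincipal_tail wU wn n0)).
have Fc : l2_norm n F <= c * l2_norm n F'.
  rewrite l2_norm_le ?mulr_ge0 ?sqrtr_ge0// exprMn sqr_sqr_norm.
  exact: FF.
move: Fn F'n; rewrite !ltr_norml => /andP[h1 _] /andP[h2 h3].
have -> : e = (c + 1) * (e / (c + 1)) by rewrite mulrC divfK// gt_eqF.
set d := e / (c + 1) in e1 h1 h2 h3 *.
have : c * l2_norm n F' <= c * (rnorm (Theta F') + d) by rewrite ler_wpM2l//; lra.
have : rnorm (Theta F) < l2_norm n F + d by lra.
lra.
Qed.

(** This turns the identities of [twist], valid only on deep levels, into exact identities of
    operators. *)
Lemma Theta_eq F F' n0 : l2_bounded F -> l2_bounded F' ->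
  (forall x, (n0 <= level x)%N -> F x = F' x) -> Theta F = Theta F'.
Proof.
move=> bF bF' FF; apply/eqP; rewrite -subr_eq0; apply/eqP/rnorm_eq0.
rewrite -scaleN1r addrC -ThetaL//.
apply: le_anti; rewrite rnorm_ge0 andbT -(mul0r (rnorm (Theta F))).
apply: (@Theta_le _ _ 0 n0) => //; first exact: l2_bounded_lin.
move=> n n0n; rewrite expr0n mul0r -(@piece_avg_cst R G N HN n 0).
apply: le_piece_avg => // x xn; rewrite FF ?xn// scaleN1r addNr rnorm0 expr0n.
by [].
Qed.

Variable pi : G -> B -> B.
Hypothesis Hpi : group_rep pi.
Variables s c : R.
Hypotheses (s0 : 0 < s) (c0 : 0 < c).
Hypothesis Hgrowth : forall g x, rnorm (pi g x) <= c * expR (s * l' g) * rnorm x.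
Local Notation d := (@box_dist R G N l).
Local Notation d' := (@box_dist R G N l').
Local Notation tw := (@twist R G N l B pi).

Let K0 g : 0 <= c * expR (s * l' g).
Proof. by rewrite mulr_ge0 ?expR_ge0// ltW. Qed.

Definition ultra_rep (T : box N -> box N -> R[i]) (v : E) : E :=
  Theta (tw T (projT1 (cid2 (ThetaS v)))).

Lemma tw_bounded T F : Cu d T -> l2_bounded F -> l2_bounded (tw T F).
Proof. exact: twist_l2_bounded K0 Hgrowth _ _. Qed.

(** Independence of the chosen preimage: two preimages differ by a function of norm 0 in the
    ultraproduct, and [twist T] is bounded uniformly in the level. *)
Lemma ultra_repE T F : Cu d T -> l2_bounded F ->
  ultra_rep T (Theta F) = Theta (tw T F).
Proof.
move=> CT bF; rewrite /ultra_rep; case: cid2 => /= F' bF' FF'.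
apply/eqP; rewrite -subr_eq0; apply/eqP/rnorm_eq0.
rewrite -scaleN1r addrC -ThetaL; [|exact: tw_bounded..].
have -> : (fun x => -1 *: tw T F x + tw T F' x) =
    tw T (fun x => -1 *: F x + F' x) by rewrite twist_linear.
have [C C0 HC] := twist_bound HN Hl K0 Hgrowth CT.
have bD : l2_bounded (fun x => -1 *: F x + F' x) by exact: l2_bounded_lin.
apply: le_anti; rewrite rnorm_ge0 andbT.
apply: (le_trans (@Theta_le _ (fun x => -1 *: F x + F' x) C 0 _ _ C0 _)) => //.
  exact: tw_bounded.
by rewrite ThetaL// FF' scaleN1r addNr rnorm0 mulr0.
Qed.

Lemma Cu_linear a T T' : Cu d T -> Cu d T' -> Cu d (fun x y => a * T x y + T' x y).
Proof.
move=> [[M TM] [r Tr]] [[M' TM'] [r' Tr']]; split.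
  exists (cabs a * M + M') => x y; apply: (le_trans (ler_normD _ _)).
  by rewrite rmorphD rmorphM/= -normr_cabs lerD// normrM ler_wpM2l.
exists (Num.max r r') => x y /=.
have [Txy|Txy _] := eqVneq (T x y) 0; last first.
  by apply: (le_trans (Tr x y Txy)); rewrite lee_fin le_max lexx.
rewrite Txy mulr0 add0r => /(Tr' x y)/le_trans; apply.
by rewrite lee_fin le_max lexx orbT.
Qed.

Lemma Cu_chi (D : set (box N)) : Cu d (mx_chi D).
Proof.
split.
  exists 1 => x y; rewrite /mx_chi rmorph1.
  by case: (_ && _); rewrite ?normr1// normr0 ler01.
exists 0 => x y /=; rewrite /mx_chi.
have [->|] := eqVneq x y; last by rewrite eqxx.
have [[l1 _ _ _] _ _] := Hl.
by move=> _; rewrite -[X in box_dist l y X](box_tr1 y) -l1; exact: box_dist_tr.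
Qed.

Lemma Cu_mul T T' : Cu d T -> Cu d T' -> Cu d (mx_mul T T').
Proof.
move=> CT CT'; have [M [r [M0 TM Tr]]] := Cu_bounds HN Hl CT.
have [M' [r' [M'0 TM' Tr']]] := Cu_bounds HN Hl CT'.
have [[_ _ _ lM] _ _] := Hl.
have mulE x z : mx_mul T T' x z = \sum_(y <- piece N (level x)) T x y * T' y z.
  apply: fsbig_level => // y; rewrite mulf_eq0 negb_or => /andP[/Tr[]].
  by [].
split.
  exists ((size (length_ball l r))%:R * (M * M')) => x z.
  rewrite normr_cabs lecR mulE.
  apply: (le_trans (@rnorm_sum R R[i]^o _ _ _ _)).
  apply: (@le_trans _ _ (\sum_(y <- piece N (level x)) \sum_(g <- length_ball l r)
     if y == box_tr x g then M * M' else 0)); last first.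
    rewrite exchange_big/= mulr_natl -iter_addr_0 -count_predT -big_const_seq.
    apply: ler_sum => g _.
    by rewrite -big_mkcond (sum_piece_indic HN x g (fun=> M * M')).
  apply: ler_sum => y _; rewrite [leLHS](cabsM (T x y) (T' y z)).
  have pos g : 0 <= if y == box_tr x g then M * M' else 0.
    by case: ifP => // _; rewrite mulr_ge0.
  have [->|Txy] := eqVneq (T x y) 0; first by rewrite cabs0 mul0r sumr_ge0.
  have [xy lr] := Tr x y Txy.
  have /(big_rem (nt x y)) -> : nt x y \in length_ball l r.
    by rewrite mem_length_ball.
  rewrite /= box_tr_near_translator// eqxx -[leLHS]addr0 lerD ?sumr_ge0//.
  by rewrite ler_pM ?cabs_ge0.
exists (r + r') => x z /= Txz.
have [y Txy Tyz] : exists2 y, T x y != 0 & T' y z != 0.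
  apply: contrapT => nex; move/eqP: Txz; apply; rewrite mulE big1// => y _.
  apply/eqP; rewrite mulf_eq0; apply: contrapT => /negP.
  by rewrite negb_or => /andP[Txy Tyz]; apply: nex; exists y.
have [xy lr] := Tr _ _ Txy; have [yz lr'] := Tr' _ _ Tyz.
rewrite -(box_tr_near_translator HN Hl yz) -{1}(box_tr_near_translator HN Hl xy).
rewrite box_trM//; apply: (le_trans (box_dist_tr HN l _ _)).
by rewrite lee_fin (le_trans (lM _ _))// lerD.
Qed.

Lemma ultra_rep_linear T : Cu d T -> linear (ultra_rep T).
Proof.
move=> CT a u v; have [F bF <-] := ThetaS u; have [F' bF' <-] := ThetaS v.
rewrite -ThetaL// !ultra_repE//; last exact: l2_bounded_lin.
by rewrite twist_linear// ThetaL//; exact: tw_bounded.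
Qed.

Lemma ultra_space_rep : space_rep d ultra_rep.
Proof.
split.
- move=> T CT; have [C C0 HC] := twist_bound HN Hl K0 Hgrowth CT.
  apply: (@bounded_op_intro _ _ _ _ C); first exact: ultra_rep_linear.
  move=> v; have [F bF <-] := ThetaS v; rewrite ultra_repE//.
  by apply: (@Theta_le _ _ C 0) => //; exact: tw_bounded.
- apply/funext => v; have [F bF <-] := ThetaS v.
  rewrite ultra_repE//; last exact: Cu_chi.
  have [n0 Hn0] := twist_tr HN Hl pi 1%g.
  apply: (@Theta_eq _ _ n0) => //; first by apply: tw_bounded => //; exact: Cu_chi.
  move=> x n0x; have := Hn0 F x n0x; rewrite box_tr1.
  case: Hpi => _ -> _ /= <-; rewrite /twist; apply: eq_bigr => y _.
  by rewrite box_tr1 /mx_chi in_setT andbT eq_sym.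
- move=> a T T' CT CT'; apply/funext => v; have [F bF <-] := ThetaS v.
  rewrite !ultra_repE//; last exact: Cu_linear.
  by rewrite twist_linear_mx ThetaL//; exact: tw_bounded.
- move=> T T' CT CT'; apply/funext => v; have [F bF <-] := ThetaS v; rewrite /=.
  have bTF := tw_bounded CT' bF.
  rewrite !ultra_repE//; last exact: Cu_mul.
  have [n0 Hn0] := twist_mul HN Hl Hpi F CT CT'.
  apply: (@Theta_eq _ _ n0) => //; first by apply: tw_bounded => //; exact: Cu_mul.
  exact: tw_bounded.
Qed.

(** Matrices are banded for [l] while growth is measured by [l']. On deep levels the translator of a
    nonzero entry has [l']-length at most the [l']-distance of its ends, hence at most the
    propagation. *)
Lemma ultra_rep_growth : space_small_growth d d' s c ultra_rep.
Proof.
split; first exact: ultra_space_rep.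
move=> V ptV; have [CV V01 Vr Vc] := ptV.
have [M [r [_ _ Tr]]] := Cu_bounds HN Hl CV.
have [n0 Hn0] := box_dist_eventually_ge HN r Hl Hl'.
have small (k : R) : 0 <= k ->
    (forall x y, (n0 <= level x)%N -> V x y != 0 ->
      c * expR (s * l' (nt x y)) <= k) ->
    (opnorm (ultra_rep V) <= k%:E)%E.
  move=> k0 Vk; apply: opnorm_le => // v; have [F bF <-] := ThetaS v.
  rewrite ultra_repE//; apply: (@Theta_le _ _ k n0) => //; first exact: tw_bounded.
  by move=> n; exact: (twist_growth HN Hgrowth ptV k0 Vk).
have prop_ge x y : V x y != 0 -> (d' x y <= propagation d' V)%E.
  by move=> Vxy; apply: ereal_sup_ubound; exists x, y.
(* If V = 0 the propagation is -oo and k = 0 works. Otherwise the propagation is nonnegative, so it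
   is finite or +oo. *)
have [[x0 [y0 V0]]|V0] := pselect (exists x y, V x y != 0); last first.
  apply: (@le_trans _ _ 0%E); last by rewrite mule_ge0 ?expeR_ge0// lee_fin ltW.
  apply: small => // x y _ Vxy; exfalso; apply: V0; by exists x, y.
have d0 : (0 <= d' x0 y0)%E.
  by apply: box_dist_ge => // a _; rewrite lee_fin; case: Hl' => -[].
have := le_trans d0 (prop_ge _ _ V0).
case E0 : (propagation d' V) => [p| |]// p0; last first.
  by rewrite gt0_muley ?lte_fin//= gt0_muley ?leey// lte_fin.
rewrite /= -EFinM; apply: small; first by rewrite mulr_ge0 ?expR_ge0// ltW.
move=> x y n0x Vxy; have [xy lr] := Tr _ _ Vxy.
rewrite ler_pM2l// ler_expR ler_pM2l// -lee_fin -E0.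
apply: le_trans (prop_ge _ _ Vxy).
by rewrite -[X in box_dist l' x X](box_tr_near_translator HN Hl xy) Hn0.
Qed.

(** On a constant function with invariant value, [twist T] multiplies by the row sums of T. Those of
    V and of the diagonal projection onto its range are both 1 on the range and 0 elsewhere. *)
Lemma ultra_rep_invariant v : group_invariants pi v ->
  space_invariants d ultra_rep (Theta (fun=> v)).
Proof.
move=> pv V [CV V01 Vr Vc].
have bv := @l2_bounded_cst R G N HN B v.
have Cchi := Cu_chi (pt_range V).
rewrite !ultra_repE//; congr Theta; apply/funext => x.
have [M [r [_ _ Tr]]] := Cu_bounds HN Hl CV.
rewrite /twist; under eq_bigr do rewrite pv.
under [RHS]eq_bigr do rewrite pv.
rewrite -!scaler_suml; congr (_ *: _).
rewrite [RHS](bigD1_seq x) ?piece_uniq//=; last by rewrite mem_piece.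
rewrite [X in _ = _ + X]big1 ?addr0; last first.
  by move=> y yx; rewrite /mx_chi eq_sym (negbTE yx).
rewrite /mx_chi eqxx/=.
have [|] := boolP (x \in pt_range V).
  rewrite inE => -[y Vxy]; have Vxy0 : V x y != 0 by rewrite Vxy oner_neq0.
  rewrite (bigD1_seq y) ?piece_uniq//=; last first.
    by rewrite mem_piece//; have [-> _] := Tr _ _ Vxy0.
  rewrite Vxy big1 ?addr0// => z zy; apply/eqP/negP => /negP Vxz.
  by move/eqP: zy; apply; exact: Vr Vxz Vxy0.
move=> xV; rewrite big1// => y _; case: (V01 x y) => // Vxy.
by move: xV; rewrite notin_setE; case; exists y.
Qed.

End UltraproductRepresentation.

(** * Averaging over the finite quotients *)

Section InvariantMean.
Context {R : realType} (G : groupType) (N : nat -> set G).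
Hypothesis HN : box_sequence N.
Variable l : G -> R.
Hypothesis Hl : proper_length_function l.
Variables (w : set_system nat) (wU : UltraFilter w) (wn : nonprincipal w).
Local Notation d := (@box_dist R G N l).
Local Notation nt := (near_translator l).
Implicit Types T : box N -> box N -> R[i].

(* The matrix V_g of the operator (V_g F)(x) = F(x g). *)
Definition shift_mx (a : G) : box N -> box N -> R[i] :=
  fun x y => (y == box_tr x a)%:R.

Definition diag_avg T (g : G) (n : nat) : R[i] :=
  ((size (piece N n))%:R^-1)%:C * \sum_(x <- piece N n) T x (box_tr x g).

Definition is_ultra_limit (u : nat -> R[i]) (a : R[i]) : Prop :=
  forall e : R, 0 < e -> w [set n | cabs (u n - a) < e].

(* Writing T as a finite sum of f_g V_g as for [twist], its value at g is the
   limit of the averages of f_g over the finite quotients. *)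
Definition ultra_mean T : G -> R[i] :=
  fun g => xget 0 (is_ultra_limit (diag_avg T g)).

Lemma is_ultra_limit_unique u a b :
  is_ultra_limit u a -> is_ultra_limit u b -> a = b.
Proof.
move=> ua ub; apply/eqP; rewrite -subr_eq0; apply/eqP.
apply: (@rnorm_eq0 R R[i]^o); apply: le_anti; rewrite rnorm_ge0 andbT.
apply/ler_addgt0Pr => e e0; rewrite add0r.
have e2 : 0 < e / 2 by rewrite divr_gt0.
have [n [/= un un']] := filter_ex (filterI (ua _ e2) (ub _ e2)).
apply: (le_trans (@rnorm_triB R R[i]^o a (u n) b)).
by rewrite (splitr e) ltW// ltrD// rnormBC.
Qed.

Lemma ultra_mean_eq T g a : is_ultra_limit (diag_avg T g) a -> ultra_mean T g = a.
Proof.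
move=> Ta; apply: (is_ultra_limit_unique _ Ta).
by apply: (@xgetPex _ 0 (is_ultra_limit (diag_avg T g))); exists a.
Qed.

Lemma diag_avg_bound T M g n : (forall x y, cabs (T x y) <= M) ->
  cabs (diag_avg T g n) <= M.
Proof.
move=> TM; rewrite /diag_avg cabsM cabs_real ?invr_ge0//.
rewrite -[leRHS](@piece_avg_cst R G N HN n M) ler_wpM2l ?invr_ge0//.
apply: (le_trans (@rnorm_sum R R[i]^o _ _ _ _)).
by apply: ler_sum => x _; exact: TM.
Qed.

Lemma ultra_mean_limit T g : Cu d T ->
  is_ultra_limit (diag_avg T g) (ultra_mean T g).
Proof.
move=> /(Cu_bounds HN Hl)[M [r [_ TM _]]].
have [a Ta] := @ultra_complex_limit R w wU (diag_avg T g) M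
  (fun n => diag_avg_bound g n TM).
by rewrite (ultra_mean_eq Ta).
Qed.

Lemma ultra_limit_eventually u a n0 :
  (forall n, (n0 <= n)%N -> u n = a) -> is_ultra_limit u a.
Proof.
move=> ua e e0; apply: filterS (nonprincipal_tail wU wn n0) => n /= /ua ->.
by rewrite subrr cabs0.
Qed.

(** If l g > r, then on deep levels g is itself the chosen translator from x to xg, so T vanishes at
    (x, xg) and the averages are eventually 0. *)
Lemma ultra_mean_support T : Cu d T -> exists r : R,
  (forall x y, T x y != 0 -> level x = level y /\ l (nt x y) <= r) /\
  forall g, ultra_mean T g != 0 -> l g <= r.
Proof.
move=> /(Cu_bounds HN Hl)[M [r [_ _ Tr]]]; exists r; split => // g.
apply: contraTT => lg; rewrite negbK; apply/eqP.
have [n0 Hn0] := near_translator_tr HN Hl (l g).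
apply/ultra_mean_eq/(@ultra_limit_eventually _ _ n0) => n n0n.
rewrite /diag_avg big_seq big1 ?mulr0// => x; rewrite mem_piece// => /eqP xn.
apply/eqP/negP => /negP Tx; have [_] := Tr _ _ Tx.
by rewrite Hn0 ?xn// => lr; move: lg; rewrite lr.
Qed.

Lemma ultra_mean_Cc T : Cu d T -> Cc (ultra_mean T).
Proof.
move=> /ultra_mean_support[r [_ Tr]]; have [_ _ fin] := Hl.
by apply: sub_finite_set (fin r) => g /=; exact: Tr.
Qed.

Lemma ultra_meanB T T' : Cu d T -> Cu d T' ->
  ultra_mean (T - T') = ultra_mean T - ultra_mean T'.
Proof.
move=> CT CT'; apply/funext => g; apply: ultra_mean_eq => e e0.
have e2 : 0 < e / 2 by rewrite divr_gt0.
apply: filterS (filterI (ultra_mean_limit g CT e2) (ultra_mean_limit g CT' e2)).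
move=> n /= [Tn Tn'].
have -> : diag_avg (T - T') g n - (ultra_mean T - ultra_mean T') g =
  (diag_avg T g n - ultra_mean T g) - (diag_avg T' g n - ultra_mean T' g).
  have E1 : (ultra_mean T - ultra_mean T') g =
    ultra_mean T g - ultra_mean T' g by [].
  have E2 x y : (T - T') x y = T x y - T' x y by [].
  rewrite E1 {1}/diag_avg; under eq_bigr do rewrite E2.
  rewrite sumrB mulrBr -/(diag_avg T g n) -/(diag_avg T' g n).
  by ring.
by rewrite (splitr e); apply: (le_lt_trans (@rnormB R R[i]^o _ _)); rewrite ltrD.
Qed.

Lemma mx_mul_shift a T x y : mx_mul (shift_mx a) T x y = T (box_tr x a) y.
Proof.
rewrite /mx_mul (@fsbig_level _ _ HN _ (level x)) => [|z]; last first.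
  rewrite /shift_mx; have [->|_] := eqVneq z (box_tr x a); first by [].
  by rewrite mul0r eqxx.
rewrite (bigD1_seq (box_tr x a)) ?piece_uniq//=; last by rewrite mem_piece.
rewrite big1 => [|z /negbTE zx]; last by rewrite /shift_mx zx mul0r.
by rewrite /shift_mx eqxx mul1r addr0.
Qed.

(** The entry of V_a T at (x, xg) is that of T at (xa, (xa)(a^-1 g)), and averages do not change
    under x -> xa. This equivariance takes the place of multiplicativity. *)
Lemma ultra_mean_shift a T : Cu d T ->
  ultra_mean (mx_mul (shift_mx a) T) = fun g => ultra_mean T (a^-1 * g)%g.
Proof.
move=> CT; apply/funext => g; apply: ultra_mean_eq.
have -> : diag_avg (mx_mul (shift_mx a) T) g = diag_avg T (a^-1 * g)%g.
  apply/funext => n; rewrite /diag_avg.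
  rewrite -[in RHS](sum_piece_tr HN n a).
  congr (_ * _); apply: eq_bigr => x _.
  by rewrite mx_mul_shift box_trM// mulVKg.
exact: ultra_mean_limit.
Qed.

Lemma ultra_mean1 : ultra_mean (mx_chi setT) = fun g => (g == 1%g)%:R.
Proof.
apply/funext => g; apply: ultra_mean_eq.
have [[l1 _ _ _] _ _] := Hl.
have [n0 Hn0] := proper_length_separated HN Hl (l g).
apply: (@ultra_limit_eventually _ _ n0) => n n0n.
have [->|g1] := eqVneq g 1%g.
  rewrite /diag_avg; under eq_bigr do rewrite box_tr1// /mx_chi eqxx in_setT.
  rewrite big_const_seq count_predT iter_addr_0 -(rmorph_nat (real_complex R)).
  by rewrite -rmorphM/= mulVf// pnatr_eq0 -lt0n size_piece_gt0.
rewrite /diag_avg big_seq big1 ?mulr0// => x; rewrite mem_piece// => /eqP xn.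
rewrite /mx_chi; case: eqP => //; rewrite -{1}(box_tr1 x).
move=> /(box_tr_eq HN); rewrite invg1 mul1g => Ng; move: g1.
by rewrite (Hn0 (level x) _ g Ng) ?eqxx ?xn.
Qed.

Lemma ultra_mean_star T : Cu d T ->
  ultra_mean (mx_star T) = group_star (ultra_mean T).
Proof.
move=> CT; apply/funext => g; apply: ultra_mean_eq => e e0.
apply: filterS (ultra_mean_limit g^-1%g CT e0) => n /=.
rewrite /group_star -cabs_conj rmorphB/=; congr (cabs (_ - _) < _).
rewrite /diag_avg [LHS]rmorphM rmorph_sum; congr (_ * _).
  by rewrite /= oppr0.
rewrite -[RHS](sum_piece_tr HN n g^-1%g); apply: eq_bigr => x _.
by rewrite /mx_star box_trM// mulVg box_tr1.
Qed.

Lemma shift_mx_Cu a : Cu d (shift_mx a).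
Proof.
split.
  exists 1 => x y; rewrite /shift_mx rmorph1.
  by case: (_ == _); rewrite ?normr1// normr0 ler01.
exists (l a) => x y /=; rewrite /shift_mx.
have [->|] := eqVneq y (box_tr x a); last by rewrite eqxx.
by move=> _; exact: box_dist_tr.
Qed.

Lemma shift_mx_partial_translation a : partial_translation d (shift_mx a).
Proof.
split; first exact: shift_mx_Cu.
- by move=> x y; rewrite /shift_mx; case: (_ == _); [right|left].
- move=> x y y'; rewrite /shift_mx.
  have [->|] := eqVneq y (box_tr x a); last by rewrite eqxx.
  by have [->|] := eqVneq y' (box_tr x a); last by rewrite eqxx.
- move=> x x' y; rewrite /shift_mx.
  have [->|] := eqVneq y (box_tr x a); last by rewrite eqxx.
  have [|] := eqVneq (box_tr x a) (box_tr x' a); last by rewrite eqxx.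
  by move=> /(can_inj (box_trK HN a)).
Qed.

Lemma shift_mx_range a : pt_range (shift_mx a) = setT.
Proof.
by apply/seteqP; split=> // x _; exists (box_tr x a); rewrite /shift_mx eqxx.
Qed.

Lemma sum_ultra_limit (s : seq G) (u : G -> nat -> R[i]) (v : G -> R[i])
    (b : G -> R) : (forall g, 0 <= b g) ->
  (forall g, is_ultra_limit (u g) (v g)) -> forall e : R, 0 < e ->
  w [set n | \sum_(g <- s) cabs (u g n - v g) * b g < e].
Proof.
move=> b0 uv; elim: s => [|g s IH] e e0.
  by apply: filterS filterT => n _ /=; rewrite big_nil.
have e2 : 0 < e / 2 by rewrite divr_gt0.
have b1 : 0 < b g + 1 by rewrite ltr_wpDl.
have e3 : 0 < e / 2 / (b g + 1) by rewrite divr_gt0.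
apply: filterS (filterI (IH _ e2) (uv g _ e3)) => n /= [sn gn].
rewrite big_cons (splitr e) ler_ltD//.
move: gn; rewrite ltr_pdivlMr// => /ltW; apply: le_trans.
by rewrite ler_wpM2l ?cabs_ge0// lerDl.
Qed.

Section Contraction.
Variables (B E : Banach R) (Theta : (box N -> B) -> E).
Hypothesis ThetaN : forall F, l2_bounded F -> forall e : R, 0 < e ->
  w [set n | `|l2_norm n F - rnorm (Theta F)| < e].
Variable pi : G -> B -> B.

(** The norm of an average is at most the mean m of the norms, and m is at most their quadratic mean
    because their variance is nonnegative. *)
Lemma rnorm_avg_le n (F : box N -> B) :
  rnorm (((size (piece N n))%:R^-1)%:C *: \sum_(x <- piece N n) F x) <=
  l2_norm n F.
Proof.
set m := piece_avg n (fun x => rnorm (F x)).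
have m0 : 0 <= m by apply: piece_avg_ge0 => x; exact: rnorm_ge0.
apply: (@le_trans _ _ m).
  rewrite rnormZ cabs_real ?invr_ge0// ler_wpM2l ?invr_ge0//.
  exact: rnorm_sum.
rewrite /l2_norm -[m]ger0_norm// -sqrtr_sqr ler_wsqrtr//.
have : 0 <= piece_avg n (fun x => (rnorm (F x) - m) ^+ 2).
  by apply: piece_avg_ge0 => x; rewrite sqr_ge0.
have -> : (fun x => (rnorm (F x) - m) ^+ 2) =
    (fun x => (rnorm (F x) ^+ 2 + (- 2 * m) * rnorm (F x)) + m ^+ 2).
  by apply/funext => x; ring.
rewrite !piece_avgD piece_avgZ piece_avg_cst// -/m -/(sqr_norm n F).
move: (sqr_norm n F) => q; nra.
Qed.

(** On deep levels the sum over points y can be regrouped by group elements, since each y with T x y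
    nonzero is reached by exactly one g of the ball. *)
Lemma twist_cst T r : (forall x y, T x y != 0 ->
    level x = level y /\ l (nt x y) <= r) ->
  exists n0, forall v x, (n0 <= level x)%N ->
    twist l pi T (fun=> v) x =
    \sum_(g <- length_ball l r) T x (box_tr x g) *: pi g v.
Proof.
move=> Tr; have [n0 Hn0] := near_translator_tr HN Hl r.
exists n0 => v x n0x; rewrite /twist.
transitivity (\sum_(y <- piece N (level x)) \sum_(g <- length_ball l r)
    if y == box_tr x g then T x y *: pi g v else 0).
  apply: eq_bigr => y _; rewrite -big_mkcond.
  have [->|Txy] := eqVneq (T x y) 0.
    by rewrite scale0r big1// => g _; rewrite scale0r.
  have [xy lr] := Tr _ _ Txy.
  under eq_bigl => g do rewrite -(andbT (_ == _)).
  rewrite big_seq_cond.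
  have lnt : nt x y \in length_ball l r by rewrite mem_length_ball.
  rewrite (big_unique _ (length_ball_uniq l r) lnt)//=.
    by rewrite lnt box_tr_near_translator// eqxx.
  move=> g; rewrite andbT mem_length_ball// => /andP[gr /eqP ->].
  by rewrite Hn0.
rewrite exchange_big; apply: eq_bigr => g _; rewrite -big_mkcond.
exact: (sum_piece_indic HN x g (fun y => T x y *: pi g v)).
Qed.

Lemma integrated_rep_seq (f : G -> R[i]) r v : (forall g, f g != 0 -> l g <= r) ->
  integrated_rep pi f v = \sum_(g <- length_ball l r) f g *: pi g v.
Proof.
move=> fr; have [_ _ fin] := Hl.
rewrite /integrated_rep -(fsbig_widen [set g | l g <= r])//.
  by rewrite fsbig_finite.
move=> g [_ /= gr]; apply/eqP; have [->|/fr//] := eqVneq (f g) 0.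
by rewrite scale0r eqxx.
Qed.

(** Replacing the limits by the averages of level n changes the left side little and turns it into
    the average over the piece of [twist T] on the constant v, whose norm is at most the l2 norm. *)
Lemma ultra_mean_contraction T v : Cu d T ->
  l2_bounded (twist l pi T (fun=> v)) ->
  rnorm (integrated_rep pi (ultra_mean T) v) <=
  rnorm (Theta (twist l pi T (fun=> v))).
Proof.
move=> CT bT; have [r [Tr fr]] := ultra_mean_support CT.
have [n0 Hn0] := twist_cst Tr.
rewrite (integrated_rep_seq v fr); apply/ler_addgt0Pr => e e0.
have e2 : 0 < e / 2 by rewrite divr_gt0.
have Hlim := sum_ultra_limit (length_ball l r)
  (fun g => rnorm_ge0 (pi g v)) (fun g => ultra_mean_limit g CT) e2.
have [n [[/= n1 n2] n3]] := filter_ex (filterI (filterI Hlim (ThetaN bT e2))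
  (nonprincipal_tail wU wn n0)).
set S := \sum_(g <- _) _.
set S' := \sum_(g <- length_ball l r) diag_avg T g n *: pi g v.
have S'le : rnorm S' <= l2_norm n (twist l pi T (fun=> v)).
  apply: le_trans (rnorm_avg_le n _).
  suff -> : S' = ((size (piece N n))%:R^-1)%:C *:
      \sum_(x <- piece N n) twist l pi T (fun=> v) x by [].
  transitivity (((size (piece N n))%:R^-1)%:C *: \sum_(x <- piece N n)
      \sum_(g <- length_ball l r) T x (box_tr x g) *: pi g v).
    rewrite exchange_big scaler_sumr; apply: eq_bigr => g _.
    by rewrite /diag_avg -scaler_suml scalerA.
  congr (_ *: _); rewrite big_seq [RHS]big_seq; apply: eq_bigr => x.
  by rewrite mem_piece// => /eqP xn; rewrite Hn0 ?xn.
have SS' : rnorm (S' - S) < e / 2.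
  apply: le_lt_trans n1; rewrite /S /S' -sumrB; apply: (le_trans (rnorm_sum _ _ _)).
  by apply: ler_sum => g _; rewrite -scalerBl rnormZ.
have := rnorm_triB S S' 0; rewrite !subr0 (rnormBC S S').
move: n2; rewrite ltr_norml => /andP[_ n2].
lra.
Qed.

End Contraction.

End InvariantMean.

(** * Kazhdan projections of the group *)

Section BoundedOperators.
Context {R : realType}.

Lemma bounded_op_bound (V W : normedModType R[i]) (f : V -> W) :
  bounded_op f -> exists2 C : R, 0 <= C & forall x, rnorm (f x) <= C * rnorm x.
Proof.
move=> [lf cf].
pose F : {linear V -> W} := HB.pack f (@GRing.isLinear.Build _ _ _ _ f lf).
have /linear_bounded_continuous/linear_boundedP/pinfty_ex_gt0[M M0 FM] :
  continuous F by [].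
have MR : M = (complex.Re M)%:C by rewrite RRe_real// gtr0_real.
exists (complex.Re M) => [|x]; first by rewrite -ler0c -MR ltW.
by have := FM x; rewrite /= MR !normr_rnorm -rmorphM lecR.
Qed.

(** The Cauchy modulus [n0] is a parameter and reappears in the conclusion, so that limits in
    different representations converge at the same rate. *)
Lemma operator_limit (B : Banach R) (U : nat -> B -> B) (C : nat -> R)
    (n0 : R -> nat) :
  (forall n, linear (U n)) -> (forall n x, rnorm (U n x) <= C n * rnorm x) ->
  (forall e : R, 0 < e -> forall m n x, (n0 e <= m)%N -> (n0 e <= n)%N ->
    rnorm (U m x - U n x) <= e * rnorm x) ->
  exists P : B -> B, bounded_op P /\
    forall e : R, 0 < e -> forall n x, (n0 e <= n)%N ->
      rnorm (U n x - P x) <= e * rnorm x.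
Proof.
move=> Ul UC Uc.
have lim x : {y | forall e : R, 0 < e ->
    exists m0, forall n, (m0 <= n)%N -> rnorm (U n x - y) < e}.
  apply/cid/complete_rnorm => e e0.
  have x1 : 0 < rnorm x + 1 by rewrite ltr_wpDl// rnorm_ge0.
  have e1 : 0 < e / (rnorm x + 1) by rewrite divr_gt0.
  exists (n0 (e / (rnorm x + 1))) => m n mn nn.
  apply: (le_lt_trans (Uc _ e1 m n x mn nn)).
  rewrite -{2}(divfK (lt0r_neq0 x1) e) ltr_pM2l//.
  by rewrite ltrDl.
pose P x := projT1 (lim x).
have PE x : forall e : R, 0 < e ->
    exists m0, forall n, (m0 <= n)%N -> rnorm (U n x - P x) < e.
  exact: projT2 (lim x).
have UP (e : R) : 0 < e -> forall n x, (n0 e <= n)%N ->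
    rnorm (U n x - P x) <= e * rnorm x.
  move=> e0 n x ne; apply/ler_addgt0Pr => h h0.
  have [m0 Hm0] := PE x h h0.
  apply: (le_trans (rnorm_triB _ (U (maxn m0 (n0 e)) x) _)).
  by rewrite lerD// ?Uc ?leq_maxr// ltW// Hm0// leq_maxl.
have Pl : linear P.
  move=> a x y; apply/eqP; rewrite -subr_eq0; apply/eqP/rnorm_eq0/le_anti.
  rewrite rnorm_ge0 andbT.
  (* The three approximation errors have these weights; adding 1 makes K positive. *)
  pose K := rnorm (a *: x + y) + (cabs a * rnorm x + rnorm y) + 1.
  have K1 : 0 < K.
    by rewrite ltr_wpDl ?addr_ge0 ?mulr_ge0 ?rnorm_ge0 ?cabs_ge0.
  apply/ler_addgt0Pr => e e0; rewrite add0r.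
  have e1 : 0 < e / K by rewrite divr_gt0.
  rewrite -{1}(divfK (lt0r_neq0 K1) e).
  set h := e / K in e1 *; set n := n0 h.
  apply: (@le_trans _ _ (rnorm (P (a *: x + y) - U n (a *: x + y)) +
    rnorm (U n (a *: x + y) - (a *: P x + P y)))); first exact: rnorm_triB.
  have h1 : rnorm (P (a *: x + y) - U n (a *: x + y)) <= h * rnorm (a *: x + y).
    by rewrite rnormBC UP.
  have h2 : rnorm (U n (a *: x + y) - (a *: P x + P y)) <=
      cabs a * (h * rnorm x) + h * rnorm y.
    rewrite Ul opprD addrACA -scalerBr.
    apply: (le_trans (rnormD _ _)); rewrite rnormZ lerD ?UP//.
    by rewrite ler_wpM2l ?cabs_ge0// UP.
  apply: (le_trans (lerD h1 h2)); rewrite /K; nra.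
exists P; split => //.
apply: (@bounded_op_intro _ _ _ _ (C (n0 1) + 1)) => // x.
rewrite -[P x](subrK (U (n0 1) x)).
apply: (le_trans (rnormD _ _)); rewrite addrC mulrDl lerD//.
by rewrite rnormBC UP.
Qed.

End BoundedOperators.

Section RepNorm.
Context {R : realType} (BB : Banach R -> Prop).
Context (V : zmodType) (Rep : Banach R -> Type).
Context (adm : forall B : Banach R, Rep B -> Prop).
Context (ev : forall B : Banach R, Rep B -> V -> B -> B).

Lemma rep_norm_ge0 f : (0 <= rep_norm BB adm ev f)%E.
Proof. by apply: ereal_sup_ubound; left. Qed.

Lemma rep_norm_le f (e : R) : 0 <= e ->
  (forall B, BB B -> forall pi : Rep B, adm pi ->
    forall x, rnorm (ev pi f x) <= e * rnorm x) ->
  (rep_norm BB adm ev f <= e%:E)%E.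
Proof.
move=> e0 fe; apply: ge_ereal_sup => _ [->|[B [BB_B [pi api ->]]]].
  by rewrite lee_fin.
by apply: opnorm_le => // x; exact: fe.
Qed.

Lemma rep_norm_bound f (e : R) B (pi : Rep B) : BB B -> adm pi ->
  linear (ev pi f) -> (rep_norm BB adm ev f <= e%:E)%E ->
  forall x, rnorm (ev pi f x) <= e * rnorm x.
Proof.
move=> BB_B api pil fe; apply: opnorm_bound => //; apply: le_trans fe.
by apply: ereal_sup_ubound; right; exists B; split => //; exists pi.
Qed.

End RepNorm.

Section GroupAlgebra.
Context {R : realType} (G : groupType).
Implicit Types f : G -> R[i].

Lemma Cc_seq f : Cc f -> exists2 s : seq G, uniq s & forall g, f g != 0 -> g \in s.
Proof.
move=> /finite_seqP[s fs]; exists (undup s); first exact: undup_uniq.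
by move=> g fg; rewrite mem_undup; have : [set g | f g != 0] g by []; rewrite fs.
Qed.

Lemma Cc_intro f (s : seq G) : (forall g, f g != 0 -> g \in s) -> Cc f.
Proof.
move=> fs; apply: (@sub_finite_set _ _ [set` s]) => [g /=|]; first exact: fs.
exact: finite_seq.
Qed.

Lemma CcB f f' : Cc f -> Cc f' -> Cc (f - f').
Proof.
move=> /Cc_seq[s _ fs] /Cc_seq[s' _ fs']; apply: (@Cc_intro _ (s ++ s')) => g.
have E : (f - f') g = f g - f' g by [].
rewrite E mem_cat; have [f0|/fs ->//] := eqVneq (f g) 0.
by rewrite f0 sub0r oppr_eq0 => /fs' ->; rewrite orbT.
Qed.

Lemma fsbig_seq_support (V : nmodType) (s : seq G) (F : G -> V) :
  uniq s -> (forall g, F g != 0 -> g \in s) ->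
  \sum_(g \in [set: G]) F g = \sum_(g <- s) F g.
Proof.
move=> us Fs; rewrite -(fsbig_widen [set` s])//; first by rewrite -fsbig_seq.
by move=> g [_ /= gs]; apply/eqP/negP => /negP /Fs.
Qed.

Lemma convolutionE f f' (s : seq G) : uniq s -> (forall g, f g != 0 -> g \in s) ->
  forall g, convolution f f' g = \sum_(h <- s) f h * f' (h^-1 * g)%g.
Proof.
move=> us fs g; apply: fsbig_seq_support => // h.
by rewrite mulf_eq0 negb_or => /andP[/fs].
Qed.

Variables (B : Banach R) (pi : G -> B -> B).
Hypothesis Hpi : group_rep pi.

Let pil g : linear (pi g).
Proof. by case: Hpi => /(_ g)[]. Qed.

Lemma integrated_repE f (s : seq G) x : uniq s ->
  (forall g, f g != 0 -> g \in s) ->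
  integrated_rep pi f x = \sum_(g <- s) f g *: pi g x.
Proof.
move=> us fs; apply: fsbig_seq_support => // g.
have [->|/fs//] := eqVneq (f g) 0.
by rewrite scale0r eqxx.
Qed.

Lemma integrated_rep_linear f : Cc f -> linear (integrated_rep pi f).
Proof.
move=> /Cc_seq[s us fs] a x y; rewrite !(integrated_repE _ us fs) scaler_sumr.
rewrite -big_split; apply: eq_bigr => g _.
by rewrite pil scalerDr !scalerA mulrC.
Qed.

Lemma integrated_repB f f' x : Cc f -> Cc f' ->
  integrated_rep pi (f - f') x = integrated_rep pi f x - integrated_rep pi f' x.
Proof.
move=> /Cc_seq[s us fs] /Cc_seq[s' us' fs'].
have ut : uniq (undup (s ++ s')) by exact: undup_uniq.
have mt g : (g \in undup (s ++ s')) = (g \in s) || (g \in s').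
  by rewrite mem_undup mem_cat.
have E g : (f - f') g = f g - f' g by [].
rewrite !(integrated_repE _ ut).
- by rewrite -sumrB; apply: eq_bigr => g _; rewrite E scalerBl.
- by move=> g /fs'; rewrite mt orbC => ->.
- by move=> g /fs; rewrite mt => ->.
- move=> g; rewrite mt E; have [f0|/fs ->//] := eqVneq (f g) 0.
  by rewrite f0 sub0r oppr_eq0 => /fs' ->; rewrite orbT.
Qed.

Lemma integrated_rep_translate f a x : Cc f ->
  integrated_rep pi (fun g => f (a^-1 * g)%g) x = pi a (integrated_rep pi f x).
Proof.
move=> /Cc_seq[s us fs].
rewrite (integrated_repE _ us fs) (linear_prop_sum (pil a)).
rewrite (@integrated_repE _ [seq (a * g)%g | g <- s]).
- rewrite big_map; apply: eq_bigr => g _.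
  by rewrite mulKg (linear_propZ (pil a)); case: Hpi => _ _ ->.
- by rewrite map_inj_uniq//; exact: mulgI.
- move=> g /fs gs; apply/mapP; exists (a^-1 * g)%g => //.
  by rewrite mulVKg.
Qed.

Lemma integrated_rep1 x : integrated_rep pi (fun g => (g == 1%g)%:R) x = x.
Proof.
rewrite (@integrated_repE _ [:: 1%g]) ?big_seq1 ?eqxx ?scale1r//.
  by case: Hpi => _ ->.
by move=> g; rewrite inE; have [|_] := eqVneq g 1%g; last by rewrite eqxx.
Qed.

Lemma convolution_Cc f f' : Cc f -> Cc f' -> Cc (convolution f f').
Proof.
move=> /Cc_seq[s us fs] /Cc_seq[s' us' fs'].
apply: (@Cc_intro _ [seq (h * k)%g | h <- s, k <- s']) => g.
rewrite (convolutionE _ us fs) => ng.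
have [h hs nh] : exists2 h, h \in s & f' (h^-1 * g)%g != 0.
  apply: contrapT => nex; move/eqP: ng; apply; rewrite big_seq big1// => h hs.
  apply/eqP; rewrite mulf_eq0; apply/orP; right; apply/eqP/eqP/negPn/negP => nh.
  by apply: nex; exists h.
by rewrite -(mulVKg h g); apply: allpairs_f => //; exact: fs'.
Qed.

Lemma integrated_rep_convolution f f' x : Cc f -> Cc f' ->
  integrated_rep pi (convolution f f') x =
  integrated_rep pi f (integrated_rep pi f' x).
Proof.
move=> Cf Cf'; have [s us fs] := Cc_seq Cf; have [s' us' fs'] := Cc_seq Cf'.
pose t := undup [seq (h * k)%g | h <- s, k <- s'].
have ut : uniq t by exact: undup_uniq.
have ft h g : h \in s -> f' (h^-1 * g)%g != 0 -> g \in t.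
  move=> hs nh; rewrite mem_undup -(mulVKg h g).
  by apply: allpairs_f => //; exact: fs'.
rewrite (@integrated_repE _ t)//; last first.
  move=> g; rewrite (convolutionE _ us fs) => ng.
  apply: contrapT => gt; move/eqP: ng; apply; rewrite big_seq big1// => h hs.
  apply/eqP; rewrite mulf_eq0; apply/orP; right; apply/eqP/eqP/negPn/negP => nh.
  by apply: gt; exact: ft hs nh.
rewrite (integrated_repE _ us fs).
under eq_bigr do rewrite (convolutionE _ us fs) scaler_suml.
rewrite exchange_big/= big_seq [RHS]big_seq; apply: eq_bigr => h hs.
rewrite -integrated_rep_translate// (@integrated_repE _ t)//; last first.
  by move=> g; exact: ft.
by rewrite scaler_sumr; apply: eq_bigr => g _; rewrite scalerA.
Qed.

End GroupAlgebra.

Section GrowthBound.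
Context {R : realType} (G : groupType).

Lemma small_growth_bound (l : G -> R) (s c : R) (B : Banach R) (pi : G -> B -> B) :
  group_small_growth l s c pi ->
  forall g x, rnorm (pi g x) <= c * expR (s * l g) * rnorm x.
Proof.
by move=> [[piB _ _] pig] g; apply: opnorm_bound => //; case: (piB g).
Qed.

(** The triangle inequality over the finite support of f gives a bound common to all representations
    of the given growth. *)
Lemma integrated_rep_bound (l : G -> R) (s c : R) (f : G -> R[i]) :
  0 <= c -> Cc f ->
  exists2 C : R, 0 <= C &
    forall (B : Banach R) (pi : G -> B -> B), group_small_growth l s c pi ->
    forall x, rnorm (integrated_rep pi f x) <= C * rnorm x.
Proof.
move=> c0 /Cc_seq[t ut ft].
exists (\sum_(g <- t) cabs (f g) * (c * expR (s * l g))).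
  by apply: sumr_ge0 => g _; rewrite !mulr_ge0 ?expR_ge0 ?cabs_ge0.
move=> B pi Hpi x; rewrite (integrated_repE _ _ ut ft) mulr_suml.
apply: (le_trans (rnorm_sum _ _ _)); apply: ler_sum => g _.
rewrite rnormZ -mulrA ler_wpM2l ?cabs_ge0//.
exact: small_growth_bound.
Qed.

End GrowthBound.

Section SpaceToGroup.
Context {R : realType} (BB : Banach R -> Prop) (G : groupType) (N : nat -> set G).
Hypotheses (cU : closed_ultraproducts BB) (cL : closed_L2 BB).
Hypothesis HN : box_sequence N.
Local Notation Mx := (box N -> box N -> R[i]).

Section SpaceReps.
Variable l : G -> R.
Local Notation d := (@box_dist R G N l).

Lemma mx_subE (T T' : Mx) : T - T' = (fun x y => -1 * T' x y + T x y).
Proof.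
apply/funext => x; apply/funext => y.
by rewrite mulN1r addrC.
Qed.

Lemma CuB (T T' : Mx) : Cu d T -> Cu d T' -> Cu d (T - T').
Proof. by move=> CT CT'; rewrite mx_subE; exact: Cu_linear. Qed.

Lemma space_repB (B : Banach R) (rho : Mx -> B -> B) T T' v :
  space_rep d rho -> Cu d T -> Cu d T' -> rho (T - T') v = rho T v - rho T' v.
Proof.
move=> [_ _ rl _] CT CT'; rewrite mx_subE rl//.
by rewrite scaleN1r addrC.
Qed.

Lemma Cu_star (T : Mx) : proper_length_function l -> Cu d T -> Cu d (mx_star T).
Proof.
move=> Hl CT; have [[M TM] _] := CT.
have [_ [r [_ _ Tr]]] := Cu_bounds HN Hl CT.
have [[_ _ lV _] _ _] := Hl.
split; first by exists M => x y; rewrite /mx_star normcJ.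
exists r => x y /=; rewrite /mx_star => Txy.
have Tyx : T y x != 0 by apply: contraNN Txy => /eqP ->; rewrite conjc0.
have [yx lr] := Tr _ _ Tyx.
have xE := box_tr_near_translator HN Hl yx.
have -> : y = box_tr x (near_translator l y x)^-1%g.
  by rewrite -[LHS](box_trK HN (near_translator l y x)) xE.
by apply: (le_trans (box_dist_tr HN l _ _)); rewrite lee_fin lV.
Qed.

End SpaceReps.

Variables l l' : G -> R.
Hypotheses (Hl : proper_length_function l) (Hl' : proper_length_function l').
Variables (w : set_system nat) (wU : UltraFilter w) (wn : nonprincipal w).
Local Notation d := (@box_dist R G N l).
Local Notation d' := (@box_dist R G N l').
Variables (s c : R).
Hypotheses (s0 : 0 < s) (c0 : 0 < c).

Lemma ultraproduct_representation (B : Banach R) (pi : G -> B -> B) :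
  BB B -> group_small_growth l' s c pi ->
  exists E : Banach R, BB E /\ exists (rho : Mx -> E -> E) (J : B -> E),
    [/\ space_small_growth d d' s c rho,
        forall v, rnorm (J v) <= rnorm v,
        forall v, group_invariants pi v -> space_invariants d rho (J v)
      & forall T v, Cu d T ->
          rnorm (integrated_rep pi (ultra_mean w T) v) <= rnorm (rho T (J v))].
Proof.
move=> BB_B Hpi; have [gpi _] := Hpi; have Hg := small_growth_bound Hpi.
have [E [BE [Th [TL TN TS]]]] := box_ultraproduct_model HN wU wn cU cL BB_B.
have K0 g : 0 <= c * expR (s * l' g) by rewrite mulr_ge0 ?expR_ge0// ltW.
have bcst v := @l2_bounded_cst R G N HN B v.
exists E; split => //; exists (ultra_rep l TS pi), (fun v => Th (fun=> v)); split.
- exact: (ultra_rep_growth HN Hl Hl' wU wn TL TN TS gpi s0 c0 Hg).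
- move=> v; apply/ler_addgt0Pr => e e0.
  have [m mT] := filter_ex (TN _ (bcst v) e e0).
  have lv : l2_norm m (fun _ : box N => v) = rnorm v.
    by rewrite /l2_norm /sqr_norm piece_avg_cst// sqrtr_sqr ger0_norm// rnorm_ge0.
  by move: mT; rewrite /= lv ltr_norml => /andP[mT _]; lra.
- by move=> v; exact: (ultra_rep_invariant HN Hl wU wn TL TN TS gpi c0 Hg).
- move=> T v CT.
  rewrite (ultra_repE HN Hl wU wn TL TN TS gpi c0 Hg CT (bcst v)).
  apply: (ultra_mean_contraction HN Hl wU wn TN CT).
  exact: (tw_bounded HN Hl c0 Hg CT (bcst v)).
Qed.

End SpaceToGroup.

Lemma near_infty_from (P : nat -> Prop) (n0 : nat) :
  (forall n, (n0 <= n)%N -> P n) -> \forall n \near \oo, P n.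
Proof. by move=> Pn; exists n0. Qed.

Lemma near_infty_exists (P : nat -> Prop) : (\forall n \near \oo, P n) ->
  exists n0, forall n, (n0 <= n)%N -> P n.
Proof. by move=> [n0 _ Pn]; exists n0. Qed.

(** * Transfer of a Kazhdan projection from a box space to the group *)

Section GeometricToGroup.
Context {R : realType} (BB : Banach R -> Prop) (G : groupType) (N : nat -> set G).
Hypotheses (cU : closed_ultraproducts BB) (cL : closed_L2 BB).
Hypothesis HN : box_sequence N.
Variables l l' l0 : G -> R.
Hypotheses (Hl : proper_length_function l) (Hl' : proper_length_function l').
Hypothesis l0l' : forall g, l0 g <= l' g.
Variables (w : set_system nat) (wU : UltraFilter w) (wn : nonprincipal w).
Local Notation d := (@box_dist R G N l).
Local Notation d' := (@box_dist R G N l').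
Variables (s c : R).
Hypotheses (s0 : 0 < s) (c0 : 0 < c).
Local Notation rnX := (rep_norm BB (@space_small_growth R _ d d' s c)
  (fun B (pi : (box N -> box N -> R[i]) -> B -> B) => pi)).
Local Notation rnG := (rep_norm BB (@group_small_growth R G l0 s c)
  (@integrated_rep R G)).
Local Notation mean := (@ultra_mean R G N w).

Lemma small_growth_le (B : Banach R) (pi : G -> B -> B) :
  group_small_growth l0 s c pi -> group_small_growth l' s c pi.
Proof.
move=> [gpi pig]; split => // g; apply: (le_trans (pig g)).
by rewrite lee_fin ler_pM2l// ler_expR ler_pM2l.
Qed.

(** Each admissible pi lifts to an admissible rho on the ultraproduct, where T acts on [J v] with
    norm at least that of pi(mean T) on v, and [J] does not increase norms. *)
Lemma rep_norm_ultra_mean T : Cu d T -> (rnG (mean T) <= rnX T)%E.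
Proof.
move=> CT; case E0 : (rnX T) => [r| |]; last 2 first.
- by rewrite leey.
- by have := rep_norm_ge0 BB (@space_small_growth R _ d d' s c)
    (fun B (pi : (box N -> box N -> R[i]) -> B -> B) => pi) T; rewrite E0.
have r0 : 0 <= r by rewrite -lee_fin -E0 rep_norm_ge0.
apply: rep_norm_le => // B BB_B pi /small_growth_le Hpi v.
have [E [BE [rho [J [rhoX JN _ rhoC]]]]] :=
  ultraproduct_representation cU cL HN Hl Hl' wU wn s0 c0 BB_B Hpi.
apply: (le_trans (rhoC T v CT)).
apply: (@le_trans _ _ (r * rnorm (J v))); last by rewrite ler_wpM2l.
have [[rb _ _ _] _] := rhoX; have [rl _] := rb T CT.
apply: (@rep_norm_bound R BB _ _ (@space_small_growth R _ d d' s c)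
  (fun B (pi : (box N -> box N -> R[i]) -> B -> B) => pi) T r E rho BE rhoX rl).
by rewrite E0.
Qed.

Variable p : nat -> box N -> box N -> R[i].
Hypothesis Hp : kazhdan_projection BB (Cu d) (@mx_mul R (box N))
  (@mx_star R (box N)) (space_small_growth d d' s c)
  (fun B (pi : (box N -> box N -> R[i]) -> B -> B) => pi) (space_invariants d) p.

Let Cp n : Cu d (p n).
Proof. by case: Hp => -[]. Qed.

Let f n : G -> R[i] := mean (p n).

Let Cf n : Cc (f n).
Proof. exact: (ultra_mean_Cc HN Hl wU wn (Cp n)). Qed.

Let cauchy (e : R) : 0 < e -> exists n0 : nat, forall m n : nat,
    (n0 <= m)%N -> (n0 <= n)%N -> (rnG (f m - f n)%R < e%:E)%E.
Proof.
case: Hp => -[_ cp] _ _ _ /cp[n0 Hn0]; exists n0 => m n mn nn.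
rewrite /f -(ultra_meanB HN Hl wU (Cp m) (Cp n)).
by apply: le_lt_trans (Hn0 m n mn nn); apply: rep_norm_ultra_mean; exact: CuB.
Qed.

(** A Cauchy modulus for the supremum norm, hence common to all representations; 0 is a default for
    e not positive. *)
Let n0 (e : R) : nat :=
  if pselect (0 < e) is left e0 then projT1 (cid (cauchy e0)) else 0%N.

Let n0P (e : R) : 0 < e -> forall (B : Banach R) (pi : G -> B -> B),
  BB B -> group_small_growth l0 s c pi ->
  forall m n x, (n0 e <= m)%N -> (n0 e <= n)%N ->
  rnorm (integrated_rep pi (f m) x - integrated_rep pi (f n) x) <= e * rnorm x.
Proof.
rewrite /n0; case: pselect => // e0 _ B pi BB_B Hpi m n x.
case: cid => /= k Hk km kn; have [gpi _] := Hpi.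
rewrite -integrated_repB//.
apply: (rep_norm_bound BB_B Hpi); last exact/ltW/Hk.
by apply: integrated_rep_linear => //; exact: CcB.
Qed.

Let space_norm_bound (E : Banach R) (rho : (box N -> box N -> R[i]) -> E -> E) Q :
  space_rep d rho ->
  completion_ev (fun B (pi : (box N -> box N -> R[i]) -> B -> B) => pi) rho p Q ->
  forall e : R, 0 < e -> exists k, forall n, (k <= n)%N -> forall x,
    rnorm (rho (p n) x - Q x) <= e * rnorm x.
Proof.
move=> [rb _ _ _] [[Ql _] Qe] e e0; have [k Hk] := near_infty_exists (Qe e e0).
exists k => n kn; apply: opnorm_bound; last exact/ltW/Hk.
have [rl _] := rb _ (Cp n).
by move=> a x y; rewrite rl Ql scalerBr opprD addrACA.
Qed.

(** P is the limit of pi(f_n). Its range is invariant: pi(a) pi(f_n) x - pi(f_n) x comes from the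
    mean of V_a p_n - p_n, so it is dominated by (rho(V_a) - 1) rho(p_n) J x, which tends to 0
    because Q J x is invariant. It fixes invariant x: there Q J x = J x, and p_n - 1 dominates
    pi(f_n) x - x. *)
Let limit_projection (B : Banach R) (pi : G -> B -> B) :
  BB B -> group_small_growth l0 s c pi ->
  exists P : B -> B, [/\ bounded_op P,
    forall e : R, 0 < e -> forall n x, (n0 e <= n)%N ->
      rnorm (integrated_rep pi (f n) x - P x) <= e * rnorm x
    & projection_onto P (group_invariants pi)].
Proof.
move=> BB_B Hpi; have [gpi _] := Hpi.
have bf n := integrated_rep_bound l0 s (ltW c0) (Cf n).
pose C n := projT1 (cid2 (bf n)).
have CP n x : rnorm (integrated_rep pi (f n) x) <= C n * rnorm x.
  by rewrite /C; case: cid2 => /= k _; exact.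
have [P [bP Pe]] := operator_limit (n0 := n0)
  (fun n => integrated_rep_linear gpi (Cf n)) CP
  (fun e e0 => n0P e0 BB_B Hpi).
exists P; split => //.
have [E [BE [rho [J [rhoX JN Jinv rhoC]]]]] :=
  ultraproduct_representation cU cL HN Hl Hl' wU wn s0 c0 BB_B (small_growth_le Hpi).
have [rX _] := rhoX; have [rb r1 _ rM] := rX.
case: (Hp) => _ _ _ /(_ E BE rho rhoX)[Q Qev [QQ Qr]].
have Qe := space_norm_bound rX Qev.
have limP x : forall e : R, 0 < e -> exists k, forall n, (k <= n)%N ->
    rnorm (integrated_rep pi (f n) x - P x) < e.
  move=> e e0; have x1 : 0 < rnorm x + 1 by rewrite ltr_wpDl// rnorm_ge0.
  have e1 : 0 < e / (rnorm x + 1) by rewrite divr_gt0.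
  exists (n0 (e / (rnorm x + 1))) => n kn; apply: (le_lt_trans (Pe _ e1 n x kn)).
  by rewrite -{2}(divfK (lt0r_neq0 x1) e) ltr_pM2l// ltrDl.
have limQ x : forall e : R, 0 < e -> exists k, forall n, (k <= n)%N ->
    rnorm (rho (p n) (J x) - Q (J x)) < e.
  move=> e e0; have x1 : 0 < rnorm (J x) + 1 by rewrite ltr_wpDl// rnorm_ge0.
  have e1 : 0 < e / (rnorm (J x) + 1) by rewrite divr_gt0.
  have [k Hk] := Qe _ e1; exists k => n kn; apply: (le_lt_trans (Hk n kn _)).
  by rewrite -{2}(divfK (lt0r_neq0 x1) e) ltr_pM2l// ltrDl.
have CSh a := shift_mx_Cu HN l a.
have Pinv x : group_invariants pi (P x).
  move=> a; apply/eqP; rewrite -subr_eq0; apply/eqP/rnorm_eq0/le_anti.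
  rewrite rnorm_ge0 andbT.
  have [K K0 HK] := bounded_op_bound (rb _ (CSh a)).
  have [K' K'0 HK'] : exists2 K : R, 0 <= K &
      forall v, rnorm (pi a v) <= K * rnorm v.
    by apply: bounded_op_bound; case: gpi.
  have [pal _] : bounded_op (pi a) by case: gpi.
  have [ral _] := rb _ (CSh a).
  apply/ler_addgt0Pr => e e0; rewrite add0r.
  (* K and K' weigh the errors that pass through rho(V_a) and pi(a); 2 counts the two errors used
     without an operator. *)
  pose M := K + K' + 2.
  have M0 : 0 < M by rewrite ltr_wpDl// addr_ge0.
  have e1 : 0 < e / M by rewrite divr_gt0.
  have [k1 Hk1] := limP x _ e1; have [k2 Hk2] := limQ x _ e1.
  set n := maxn k1 k2.
  have h1 := Hk1 n (leq_maxl _ _); have h2 := Hk2 n (leq_maxr _ _).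
  set u := integrated_rep pi (f n) x in h1.
  set v := rho (p n) (J x) in h2.
  have h3 : rnorm (pi a u - u) <= rnorm (rho (shift_mx a) v - v).
    have CS : Cu d (mx_mul (shift_mx a) (p n)) by exact: Cu_mul.
    have -> : pi a u - u =
        integrated_rep pi (mean (mx_mul (shift_mx a) (p n) - p n)) x.
      rewrite (ultra_meanB HN Hl wU CS (Cp n)) integrated_repB.
      2: exact: (ultra_mean_Cc HN Hl wU wn CS).
      2: exact: Cf.
      rewrite (ultra_mean_shift HN Hl wU a (Cp n)) /u.
      by rewrite -(integrated_rep_translate gpi a x (Cf n)).
    apply: (le_trans (rhoC _ _ (CuB CS (Cp n)))).
    by rewrite (space_repB _ rX CS (Cp n)) rM.
  have QJ : rho (shift_mx a) (Q (J x)) = Q (J x).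
    have : space_invariants d rho (Q (J x)) by rewrite -Qr; exists (J x).
    move/(_ _ (shift_mx_partial_translation HN l a)) => ->.
    by rewrite shift_mx_range r1.
  have h4 : rnorm (rho (shift_mx a) v - v) <= K * (e / M) + e / M.
    apply: (le_trans (rnorm_triB _ (Q (J x)) _)); rewrite lerD//.
      rewrite -{1}QJ -(linear_propB ral); apply: (le_trans (HK _)).
      by rewrite ler_wpM2l// ltW.
    by rewrite rnormBC ltW.
  have h5 : rnorm (pi a (P x) - pi a u) <= K' * (e / M).
    rewrite -(linear_propB pal); apply: (le_trans (HK' _)).
    by rewrite ler_wpM2l// rnormBC ltW.
  apply: (le_trans (rnorm_triB _ (pi a u) _)).
  apply: (le_trans (lerD h5 (rnorm_triB _ u _))).
  have h6 : rnorm (pi a u - u) <= K * (e / M) + e / M by exact: le_trans h3 h4.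
  have eM : e = K' * (e / M) + ((K * (e / M) + e / M) + e / M).
    by rewrite -{1}(divfK (lt0r_neq0 M0) e) {2}/M; ring.
  by rewrite [leRHS]eM lerD2l lerD// ltW.
have Pfix x : group_invariants pi x -> P x = x.
  move=> xinv; apply/eqP; rewrite -subr_eq0; apply/eqP/rnorm_eq0/le_anti.
  rewrite rnorm_ge0 andbT; apply/ler_addgt0Pr => e e0; rewrite add0r.
  have e1 : 0 < e / 2 by rewrite divr_gt0.
  have [k1 Hk1] := limP x _ e1; have [k2 Hk2] := limQ x _ e1.
  set n := maxn k1 k2.
  have h1 := Hk1 n (leq_maxl _ _); have h2 := Hk2 n (leq_maxr _ _).
  apply: (le_trans (rnorm_triB _ (integrated_rep pi (f n) x) _)).
  rewrite (splitr e) lerD//; first by rewrite rnormBC ltW.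
  apply: le_trans (ltW h2).
  have -> : Q (J x) = J x.
    have : space_invariants d rho (J x) by exact: Jinv.
    by rewrite -Qr => -[y _ <-].
  (* The mean of the identity matrix is the unit of the group algebra, so x itself is in the image
     of the mean. *)
  have C1 := Cu_chi HN Hl setT.
  have -> : integrated_rep pi (f n) x - x =
      integrated_rep pi (mean (p n - mx_chi setT)) x.
    rewrite (ultra_meanB HN Hl wU (Cp n) C1) integrated_repB.
    2: exact: Cf.
    2: exact: (ultra_mean_Cc HN Hl wU wn C1).
    by rewrite (ultra_mean1 HN Hl wU wn) integrated_rep1.
  apply: (le_trans (rhoC _ _ (CuB (Cp n) C1))).
  by rewrite (space_repB _ rX (Cp n) C1) r1.
split; first by move=> x; exact: Pfix.
apply/seteqP; split=> [_ [x _ <-]//|x xinv].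
by exists x => //; exact: Pfix.
Qed.

Lemma kazhdan_projection_ultra_mean :
  kazhdan_projection BB (@Cc R G) (@convolution R G) (@group_star R G)
    (group_small_growth l0 s c) (@integrated_rep R G) (@group_invariants R G) f.
Proof.
split.
- by split; [exact: Cf|exact: cauchy].
- case: Hp => _ ps _ _ e e0; have [k Hk] := near_infty_exists (ps e e0).
  apply: (@near_infty_from _ k) => n kn; apply: le_lt_trans (Hk n kn).
  have CS := Cu_star HN Hl (Cp n).
  rewrite /f -(ultra_mean_star HN Hl wU (Cp n)) -(ultra_meanB HN Hl wU CS (Cp n)).
  by apply: rep_norm_ultra_mean; exact: CuB.
- move=> e e0.
  (* In every representation the term of index [n0 1] is bounded by C, hence later terms by C + 1
     and the limit P by C + 2. *)
  have [C C0 HC] := integrated_rep_bound l0 s (ltW c0) (Cf (n0 1)).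
  pose M := C + 2; have M0 : 0 < M by rewrite ltr_wpDl.
  (* With U = pi(f_n), write UU - U as (U - P)U + P(U - P) + (P - U), using PP = P. The terms cost
     hM, Mh and h; halving e gives a strict inequality. *)
  pose h := e / 2 / (2 * M + 1).
  have K0 : 0 < 2 * M + 1 by rewrite addr_gt0// mulr_gt0.
  have h0 : 0 < h by rewrite !divr_gt0.
  apply: (@near_infty_from _ (maxn (n0 1) (n0 h))) => n.
  rewrite geq_max => /andP[n1 nh].
  apply: (@le_lt_trans _ _ (e / 2)%:E); last first.
    by rewrite lte_fin ltr_pdivrMr// mulr_natr mulr2n ltrDl.
  apply: rep_norm_le => [|B BB_B pi Hpi x]; first by rewrite ltW// divr_gt0.
  have [gpi _] := Hpi; have CC := convolution_Cc (Cf n) (Cf n).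
  rewrite integrated_repB// integrated_rep_convolution//.
  have [P [bP Pe [PP _]]] := limit_projection BB_B Hpi; have [Pl _] := bP.
  set U := integrated_rep pi (f n).
  have U1 y : rnorm (U y) <= (C + 1) * rnorm y.
    rewrite -[U y](subrK (integrated_rep pi (f (n0 1)) y)) mulrDl addrC.
    by apply: (le_trans (rnormD _ _)); rewrite lerD ?HC ?n0P.
  have UM y : rnorm (U y) <= M * rnorm y.
    by apply: (le_trans (U1 y)); rewrite ler_wpM2r ?rnorm_ge0// lerD2l ler1n.
  have PM y : rnorm (P y) <= M * rnorm y.
    rewrite -[P y](subrK (U y)); apply: (le_trans (rnormD _ _)).
    have -> : M = 1 + (C + 1) by rewrite /M addrCA.
    by rewrite mulrDl lerD// rnormBC Pe.
  have g1 := Pe h h0 n (U x) nh; have g2 := Pe h h0 n x nh.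
  have g3 := PM (U x - P x); rewrite (linear_propB Pl) PP in g3.
  apply: (le_trans (rnorm_triB _ (P (U x)) _)).
  apply: (@le_trans _ _ (h * rnorm (U x) +
    (M * rnorm (U x - P x) + rnorm (U x - P x)))).
    rewrite lerD//; apply: (le_trans (rnorm_triB _ (P x) _)).
    by rewrite lerD// rnormBC.
  apply: (@le_trans _ _ (h * (M * rnorm x) + (M * (h * rnorm x) + h * rnorm x))).
    rewrite !lerD//; first by rewrite ler_pM2l.
    by rewrite ler_pM2l.
  rewrite [leLHS](_ : _ = h * (2 * M + 1) * rnorm x); last by ring.
  by rewrite /h divfK// gt_eqF.
- move=> B BB_B pi Hpi; have [P [bP Pe Pproj]] := limit_projection BB_B Hpi.
  exists P => //; split => // e e0.
  have e2 : 0 < e / 2 by rewrite divr_gt0.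
  apply: (@near_infty_from _ (n0 (e / 2))) => n ne.
  apply: (@le_lt_trans _ _ (e / 2)%:E); last first.
    by rewrite lte_fin ltr_pdivrMr// mulr_natr mulr2n ltrDl.
  by apply: opnorm_le => [|x]; [exact: ltW|exact: Pe].
Qed.

End GeometricToGroup.

Lemma proper_length_functionD (R : realType) (G : groupType) (l0 l : G -> R) :
  length_function l0 -> proper_length_function l ->
  proper_length_function (fun g => l0 g + l g).
Proof.
move=> [l01 l0g l0V l0M] [[l1 lg lV lM] le lf]; split; first split.
- by rewrite l01 l1 addr0.
- by move=> g; rewrite addr_ge0.
- by move=> g; rewrite l0V lV.
- by move=> g h; rewrite addrACA lerD.
- move=> g E0; apply: le; apply: le_anti; rewrite lg andbT -E0 lerDr.
  exact: l0g.
- move=> r; apply: sub_finite_set (lf r) => g /=; apply: le_trans.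
  by rewrite lerDr.
Qed.

Lemma strong_Banach_T_of_geometric (R : realType) (BB : Banach R -> Prop)
    (G : groupType) (N : nat -> set G) (l : G -> R) :
  closed_ultraproducts BB -> closed_L2 BB ->
  box_sequence N -> proper_length_function l ->
  geometric_strong_Banach_T BB (@box_dist R G N l) (@Dl R G N) ->
  strong_Banach_T G BB.
Proof.
move=> cU cL HN Hl geoT l0 Hl0.
(* If l0 is not proper, its quotient metrics may stay below it on every level,
   so the growth of the ultraproduct representation is controlled by l0 + l. *)
have Hl' := proper_length_functionD Hl0 Hl; set l' := fun g => _ in Hl'.
have [|s s0 Hs] := geoT (box_dist l'); first by exists l' => //; case: Hl'.
exists s => // c c0; have [p Hp] := Hs c c0.
have [w wU wn] := nonprincipal_ultrafilter_exists.
exists (fun n => ultra_mean w (p n)).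
apply: (kazhdan_projection_ultra_mean cU cL HN Hl Hl' _ wU wn s0 c0 Hp).
by move=> g; rewrite /l' lerDl; case: Hl => -[].
Qed.

(** * From representations of the box space to the group *)

Section GroupToSpace.
Context {R : realType} (BB : Banach R -> Prop) (G : groupType) (N : nat -> set G).
Hypothesis HN : box_sequence N.
Variable l : G -> R.
Hypothesis Hl : proper_length_function l.
Local Notation Mx := (box N -> box N -> R[i]).
Local Notation d := (@box_dist R G N l).
Local Notation nt := (near_translator l).

(** Linearity in [space_rep] is stated for a T + T', so the zero matrix is presented in this form
    from the identity. *)
Lemma mx_sum_nil (I : Type) (a : I -> R[i]) (T : I -> Mx) :
  (fun x y => \sum_(i <- [::]) a i * T i x y) =
  (fun x y => -1 * mx_chi setT x y + mx_chi setT x y).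
Proof.
apply/funext => x; apply/funext => y.
by rewrite big_nil mulN1r addNr.
Qed.

Lemma mx_sum_cons (I : Type) i (s : seq I) (a : I -> R[i]) (T : I -> Mx) :
  (fun x y => \sum_(j <- i :: s) a j * T j x y) =
  (fun x y => a i * T i x y + \sum_(j <- s) a j * T j x y).
Proof. by apply/funext => x; apply/funext => y; rewrite big_cons. Qed.

Lemma Cu_sum (I : Type) (s : seq I) (a : I -> R[i]) (T : I -> Mx) :
  (forall i, Cu d (T i)) -> Cu d (fun x y => \sum_(i <- s) a i * T i x y).
Proof.
move=> CT; elim: s => [|i s IH].
  by rewrite mx_sum_nil; apply: Cu_linear; exact: Cu_chi.
by rewrite mx_sum_cons; exact: Cu_linear.
Qed.

Lemma space_rep_sum (B : Banach R) (rho : Mx -> B -> B) (I : Type) (s : seq I)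
    (a : I -> R[i]) (T : I -> Mx) v : space_rep d rho -> (forall i, Cu d (T i)) ->
  rho (fun x y => \sum_(i <- s) a i * T i x y) v = \sum_(i <- s) a i *: rho (T i) v.
Proof.
move=> [_ _ rl _] CT; elim: s => [|i s IH].
  rewrite mx_sum_nil rl; [|exact: Cu_chi|exact: Cu_chi].
  by rewrite scaleN1r addNr big_nil.
by rewrite mx_sum_cons rl//; [rewrite IH big_cons|exact: Cu_sum].
Qed.

Definition shift_algebra (f : G -> R[i]) : Mx :=
  fun x y => \sum_(g \in [set: G]) f g * shift_mx g x y.

Lemma shift_algebraE f (s : seq G) : uniq s -> (forall g, f g != 0 -> g \in s) ->
  shift_algebra f = (fun x y => \sum_(g <- s) f g * shift_mx g x y).
Proof.
move=> us fs; apply/funext => x; apply/funext => y.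
apply: fsbig_seq_support => // g.
by rewrite mulf_eq0 negb_or => /andP[/fs].
Qed.

Lemma shift_algebra_Cu f : Cc f -> Cu d (shift_algebra f).
Proof.
move=> /Cc_seq[s us fs]; rewrite (shift_algebraE us fs).
by apply: Cu_sum => g; exact: shift_mx_Cu.
Qed.

Lemma shift_algebraB f f' : Cc f -> Cc f' ->
  shift_algebra (f - f') = shift_algebra f - shift_algebra f'.
Proof.
move=> /Cc_seq[s us fs] /Cc_seq[s' us' fs'].
have ut : uniq (undup (s ++ s')) by exact: undup_uniq.
have mt g : (g \in undup (s ++ s')) = (g \in s) || (g \in s').
  by rewrite mem_undup mem_cat.
have E g : (f - f') g = f g - f' g by [].
rewrite !(shift_algebraE ut).
- apply/funext => x; apply/funext => y.
  have E' (A A' : Mx) : (A - A') x y = A x y - A' x y by [].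
  by rewrite E' -sumrB; apply: eq_bigr => g _; rewrite E mulrBl.
- by move=> g /fs'; rewrite mt orbC => ->.
- by move=> g /fs; rewrite mt => ->.
- move=> g; rewrite mt E; have [f0|/fs ->//] := eqVneq (f g) 0.
  by rewrite f0 sub0r oppr_eq0 => /fs' ->; rewrite orbT.
Qed.

Lemma shift_algebra_star f : Cc f ->
  mx_star (shift_algebra f) = shift_algebra (group_star f).
Proof.
move=> /Cc_seq[s us fs]; rewrite (shift_algebraE us fs).
rewrite (@shift_algebraE _ [seq g^-1%g | g <- s]).
- apply/funext => x; apply/funext => y; rewrite /mx_star rmorph_sum big_map.
  apply: eq_bigr => g _; rewrite /group_star invgK rmorphM; congr (_ * _).
  rewrite /shift_mx; have -> : (x == box_tr y g) = (y == box_tr x g^-1%g).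
    by apply/eqP/eqP => ->; rewrite box_trM// ?mulgV ?mulVg box_tr1.
  by case: (_ == _); rewrite ?rmorph1 ?rmorph0.
- by rewrite map_inj_uniq//; exact: invg_inj.
- move=> g; rewrite /group_star conjc_eq0 => /fs gs.
  by apply/mapP; exists g^-1%g; rewrite ?invgK.
Qed.

Lemma group_star_Cc (f : G -> R[i]) : Cc f -> Cc (group_star f).
Proof.
move=> /Cc_seq[s us fs]; apply: (@Cc_intro _ _ _ [seq g^-1%g | g <- s]) => g.
rewrite /group_star conjc_eq0 => /fs gs.
by apply/mapP; exists g^-1%g; rewrite ?invgK.
Qed.

Section Restriction.
Variables (B : Banach R) (rho : Mx -> B -> B).
Hypothesis Hrho : space_rep d rho.

Definition shift_rep (g : G) : B -> B := rho (shift_mx g).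

Lemma shift_rep_group_rep : group_rep shift_rep.
Proof.
case: (Hrho) => rb r1 _ rM; split.
- by move=> g; apply: rb; exact: shift_mx_Cu.
- rewrite /shift_rep -r1; congr rho; apply/funext => x; apply/funext => y.
  by rewrite /shift_mx /mx_chi box_tr1 in_setT andbT eq_sym.
- move=> g h; rewrite /shift_rep -rM; [|exact: shift_mx_Cu|exact: shift_mx_Cu].
  congr rho; apply/funext => x; apply/funext => y.
  by rewrite mx_mul_shift// /shift_mx box_trM.
Qed.

Lemma shift_algebra_rep f : Cc f ->
  rho (shift_algebra f) = integrated_rep shift_rep f.
Proof.
move=> /Cc_seq[s us fs]; rewrite (shift_algebraE us fs); apply/funext => v.
rewrite (integrated_repE _ _ us fs) space_rep_sum// => g.
exact: shift_mx_Cu.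
Qed.

(** Since x and xg are at [l']-distance at most l' g, the propagation of V_g is at most l' g. *)
Lemma shift_rep_growth (l' : G -> R) (s c : R) : 0 < s -> 0 < c ->
  space_small_growth d (@box_dist R G N l') s c rho ->
  group_small_growth l' s c shift_rep.
Proof.
move=> s0 c0 [_ rg]; split; first exact: shift_rep_group_rep.
move=> g; apply: (le_trans (rg _ (shift_mx_partial_translation HN l g))).
rewrite EFinM lee_pmul2l ?lte_fin//.
rewrite -[(expR _)%:E]/(expeR (s * l' g)%:E) lee_expeR EFinM lee_pmul2l ?lte_fin//.
apply: ge_ereal_sup => _ [x [y [+ ->]]]; rewrite /shift_mx.
have [-> _|] := eqVneq y (box_tr x g); last by rewrite eqxx.
exact: box_dist_tr.
Qed.

Lemma space_invariants_shift : space_invariants d rho = group_invariants shift_rep.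
Proof.
have [rb r1 rl rM] := Hrho.
apply/seteqP; split=> v vinv.
  move=> g; rewrite /shift_rep (vinv _ (shift_mx_partial_translation HN l g)).
  by rewrite shift_mx_range r1.
move=> V [CV V01 Vr Vc].
have [M [r [_ _ Tr]]] := Cu_bounds HN Hl CV.
have Vne x y : V x y = 1 -> V x y != 0 by move=> ->; rewrite oner_neq0.
pose L := length_ball l r.
(* The rows of V whose nonzero entry is reached by the translator g. These sets partition the range
   of V, and only g in the finite ball L occur. *)
pose D g : set (box N) := [set x | exists2 y, V x y = 1 & nt x y = g].
have VE : V = (fun x y => \sum_(g <- L) 1 * mx_mul (mx_chi (D g)) (shift_mx g) x y).
  apply/funext => x; apply/funext => y.
  have mE g : mx_mul (mx_chi (D g)) (shift_mx g) x y =
      ((x \in D g) && (y == box_tr x g))%:R.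
    rewrite /mx_mul (@fsbig_level _ _ HN _ (level x)) => [|z]; last first.
      rewrite /mx_chi; have [->|_] := eqVneq x z; first by [].
      by rewrite mul0r eqxx.
    rewrite (bigD1_seq x) ?piece_uniq//=; last by rewrite mem_piece.
    rewrite big1 => [|z /negbTE zx]; last by rewrite /mx_chi eq_sym zx mul0r.
    rewrite addr0 /mx_chi eqxx/= /shift_mx.
    by case: (_ \in _); case: (_ == _); rewrite ?mul1r ?mul0r.
  under eq_bigr do rewrite mul1r mE.
  have [Vxy|Vxy] := V01 x y.
    rewrite Vxy big1// => g _; case: (boolP (_ && _)) => //.
    case/andP; rewrite inE => -[z Vxz <-] /eqP yz; move: Vxy.
    have [xz _] := Tr _ _ (Vne _ _ Vxz).
    by rewrite yz box_tr_near_translator// Vxz => /eqP; rewrite oner_eq0.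
  have [xy lr] := Tr _ _ (Vne _ _ Vxy).
  rewrite Vxy (bigD1_seq (nt x y)) ?length_ball_uniq ?mem_length_ball//=.
  rewrite box_tr_near_translator// eqxx andbT mem_set; last by exists y.
  rewrite big1 ?addr0// => g /eqP gnt; case: (boolP (_ && _)) => //.
  case/andP; rewrite inE => -[z Vxz zg] _; case: gnt; rewrite -zg.
  by congr nt; exact: Vr (Vne _ _ Vxz) (Vne _ _ Vxy).
have chiE : (mx_chi (pt_range V) : Mx) =
    (fun x y => \sum_(g <- L) 1 * mx_chi (D g) x y).
  apply/funext => x; apply/funext => y; rewrite /mx_chi.
  under eq_bigr do rewrite mul1r.
  have [_|_] := eqVneq x y; last by rewrite big1.
  have [|xV] := boolP (x \in pt_range V).
    rewrite inE => -[z Vxz]; have [xz lr] := Tr _ _ (Vne _ _ Vxz).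
    rewrite (bigD1_seq (nt x z)) ?length_ball_uniq ?mem_length_ball//=.
    rewrite mem_set; last by exists z.
    rewrite big1 ?addr0// => g /eqP gnt; case: (boolP (_ \in D g)) => //.
    rewrite inE => -[z' Vxz' zg]; case: gnt; rewrite -zg.
    by congr nt; exact: Vr (Vne _ _ Vxz') (Vne _ _ Vxz).
  rewrite big1// => g _; case: (boolP (_ \in D g)) => //; rewrite inE => -[z Vxz _].
  by move: xV; rewrite notin_setE; case; exists z.
have CD g : Cu d (mx_chi (D g)) by exact: Cu_chi.
have CS g := shift_mx_Cu HN l g.
rewrite chiE VE !space_rep_sum//; last by move=> g; exact: Cu_mul.
(* As V_g fixes v, both sides are the sum of the rho(mx_chi (D g)) v. *)
by apply: eq_bigr => g _; rewrite rM//= [rho (shift_mx g) v]vinv.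
Qed.

End Restriction.

Variables (l' : G -> R) (s c : R).
Hypotheses (s0 : 0 < s) (c0 : 0 < c).
Local Notation d' := (@box_dist R G N l').
Local Notation rnX := (rep_norm BB (@space_small_growth R _ d d' s c)
  (fun B (pi : (box N -> box N -> R[i]) -> B -> B) => pi)).
Local Notation rnG := (rep_norm BB (@group_small_growth R G l' s c)
  (@integrated_rep R G)).

(** Every admissible rho restricts to an admissible representation of G, so each operator norm on
    the left also occurs on the right. *)
Lemma rep_norm_shift (T : Mx) (f : G -> R[i]) :
  (forall (B : Banach R) (rho : Mx -> B -> B), space_rep d rho ->
    rho T = integrated_rep (shift_rep rho) f) ->
  (rnX T <= rnG f)%E.
Proof.
move=> Tf; apply: ge_ereal_sup => _ [->|[B [BB_B [rho Hrho ->]]]].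
  exact: rep_norm_ge0.
apply: ereal_sup_ubound; right; exists B; split => //.
exists (shift_rep rho); first by apply: shift_rep_growth => //; case: Hrho.
by rewrite Tf//; case: Hrho.
Qed.

Lemma kazhdan_projection_shift_algebra (p : nat -> G -> R[i]) :
  kazhdan_projection BB (@Cc R G) (@convolution R G) (@group_star R G)
    (group_small_growth l' s c) (@integrated_rep R G) (@group_invariants R G) p ->
  kazhdan_projection BB (Cu d) (@mx_mul R (box N)) (@mx_star R (box N))
    (space_small_growth d d' s c)
    (fun B (pi : (box N -> box N -> R[i]) -> B -> B) => pi) (space_invariants d)
    (fun n => shift_algebra (p n)).
Proof.
move=> [[Cp cp] ps pm pP].
have CS n := shift_algebra_Cu (Cp n).
split.
- split => // e e0; have [k Hk] := cp e e0; exists k => m n mn nn.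
  apply: le_lt_trans (Hk m n mn nn); rewrite -shift_algebraB//.
  by apply: rep_norm_shift => B rho Hrho; apply: shift_algebra_rep => //; exact: CcB.
- move=> e e0; have [k Hk] := near_infty_exists (ps e e0).
  apply: (@near_infty_from _ k) => n kn; apply: le_lt_trans (Hk n kn).
  rewrite shift_algebra_star// -shift_algebraB//; last exact: group_star_Cc.
  apply: rep_norm_shift => B rho Hrho; apply: shift_algebra_rep => //.
  by apply: CcB => //; exact: group_star_Cc.
- move=> e e0; have [k Hk] := near_infty_exists (pm e e0).
  apply: (@near_infty_from _ k) => n kn; apply: le_lt_trans (Hk n kn).
  (* The two products are compared through rho: it sends the matrix product, and [shift_rep rho]
     sends the convolution, to the same composition of operators. *)
  apply: rep_norm_shift => B rho Hrho; apply/funext => v.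
  have [_ _ _ rM] := Hrho.
  rewrite (space_repB _ Hrho)//; last exact: Cu_mul.
  have gr := shift_rep_group_rep Hrho.
  rewrite integrated_repB//; last exact: convolution_Cc.
  by rewrite integrated_rep_convolution// rM//= shift_algebra_rep.
- move=> B BB_B rho Hrho; have [rr _] := Hrho.
  have [P [bP Pe] Pproj] := pP B BB_B _ (shift_rep_growth rr s0 c0 Hrho).
  exists P; last by rewrite space_invariants_shift.
  split => // e e0; have [k Hk] := near_infty_exists (Pe e e0).
  apply: (@near_infty_from _ k) => n kn.
  by rewrite shift_algebra_rep//; exact: Hk.
Qed.

End GroupToSpace.

Lemma geometric_of_strong_Banach_T (R : realType) (BB : Banach R -> Prop)
    (G : groupType) (N : nat -> set G) (l : G -> R) :
  box_sequence N -> proper_length_function l ->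
  strong_Banach_T G BB ->
  geometric_strong_Banach_T BB (@box_dist R G N l) (@Dl R G N).
Proof.
move=> HN Hl sT _ [l' Hl' ->]; have [s s0 Hs] := sT l' Hl'.
exists s => // c c0; have [p Hp] := Hs c c0.
exists (fun n => @shift_algebra R G N (p n)).
exact: kazhdan_projection_shift_algebra.
Qed.

(** * Existence of box spaces and of proper lengths *)

Section Existence.
Context (G : groupType).
Hypothesis Gc : countable [set: G].

Lemma finite_index_normalT : finite_index_normal [set: G].
Proof.
split => //; apply: (@sub_finite_set _ _ [set [set: G]]); last exact: finite_set1.
move=> _ [g _ <-] /=; apply/seteqP; split=> // h _.
by exists (g^-1 * h)%g => //; rewrite mulVKg.
Qed.

(** A coset of the intersection is the intersection of a coset of A with one of B, and there are
    finitely many such pairs. *)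
Lemma finite_index_normalI (A B : set G) :
  finite_index_normal A -> finite_index_normal B ->
  finite_index_normal (A `&` B).
Proof.
move=> [A1 AM AJ fA] [B1 BM BJ fB]; split.
- by split.
- by move=> g h [Ag Bg] [Ah Bh]; split; [exact: AM|exact: BM].
- by move=> g h [Ah Bh]; split; [exact: AJ|exact: BJ].
apply: sub_finite_set (finite_image (fun z => z.1 `&` z.2) (finite_setX fA fB)).
move=> _ [g _ <-]; exists (lcoset g A, lcoset g B).
  by split; exists g.
apply/seteqP; split=> [h [/= [a Aa <-] [b Bb /mulgI ba]]|_ [a [Aa Ba] <-]].
  by exists a => //; split => //; rewrite -ba.
by split; exists a.
Qed.

Lemma box_sequence_exists : residually_finite G -> exists N, @box_sequence G N.
Proof.
move=> rf; have /countable_injP[e /in2TT e_inj] := Gc.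
(* [M k] misses the nontrivial element numbered k by e, and is the whole group if there is none; the
   running intersections N are then nested with trivial intersection. *)
have M_ex k : {M : set G | finite_index_normal M &
    forall g, g != 1%g -> e g = k -> ~ M g}.
  apply: cid2; have [[g [g1 gk]]|nog] := pselect (exists g, g != 1%g /\ e g = k).
    have [M fM Mg] := rf g g1; exists M => // h _ hk.
    by rewrite (e_inj h g)// hk.
  exists setT; first exact: finite_index_normalT.
  by move=> g g1 gk; case: nog; exists g.
pose M k := s2val (M_ex k).
have fM k : finite_index_normal (M k) by exact: s2valP (M_ex k).
have MP k g : g != 1%g -> e g = k -> ~ M k g by exact: s2valP' (M_ex k) g.
pose N := fix N n := if n is k.+1 then N k `&` M k.+1 else M 0%N.
have NM n : N n `<=` M n by case: n => //= n g [].
exists N; split.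
- by elim=> [|n IH] /=; [exact: fM|exact: finite_index_normalI].
- by move=> n g [].
- apply/seteqP; split=> [g Ng|_ -> n _]; last first.
    elim: n => [|n IH] /=; first by case: (fM 0%N).
    by split => //; case: (fM n.+1).
  apply: contrapT => /eqP g1.
  exact: MP g1 (erefl (e g)) (NM _ _ (Ng (e g) Logic.I)).
Qed.

Lemma proper_length_function_exists (R : realType) :
  exists l : G -> R, proper_length_function l.
Proof.
have /countable_injP[e /in2TT e_inj] := Gc.
(* A weighted word length with all elements as generators. The minimum makes weights symmetric,
   injectivity of e makes each bounded set of weights finite, and the successor makes every letter
   cost at least 1. *)
pose wt (g : G) : nat := (minn (e g) (e g^-1%g)).+1.
have wtV g : wt g^-1%g = wt g by rewrite /wt invgK minnC.
pose gp (s : seq G) : G := foldr (fun x y => x * y)%g 1%g s.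
have gp_cat s t : gp (s ++ t) = (gp s * gp t)%g.
  by elim: s => [|x s IH] /=; rewrite ?mul1g// IH mulgA.
pose wlen (s : seq G) : nat := (\sum_(x <- s) wt x)%N.
have ex g : exists n, `[< exists2 s, gp s = g & wlen s = n >].
  exists (wt g); apply/asboolP; exists [:: g]; first by rewrite /= mulg1.
  by rewrite /wlen big_seq1.
pose len g := ex_minn (ex g).
have len_word g : exists2 s, gp s = g & wlen s = len g.
  by rewrite /len; case: ex_minnP => n /asboolP.
have len_le s : (len (gp s) <= wlen s)%N.
  rewrite /len; case: ex_minnP => n _; apply.
  by apply/asboolP; exists s.
have lenM g h : (len (g * h)%g <= len g + len h)%N.
  have [s <- <-] := len_word g; have [t <- <-] := len_word h.
  by rewrite -gp_cat (leq_trans (len_le _))// /wlen big_cat.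
have lenV_le g : (len g^-1%g <= len g)%N.
  have [s <- <-] := len_word g.
  have -> : (gp s)^-1%g = gp (rev [seq x^-1%g | x <- s]).
    elim: s => [|x s IH] /=; first by rewrite invg1.
    by rewrite rev_cons -cats1 gp_cat invgM IH /= mulg1.
  apply: (leq_trans (len_le _)); rewrite /wlen (perm_big [seq x^-1%g | x <- s]).
    by rewrite big_map; apply: leq_sum => x _; rewrite wtV.
  by rewrite perm_rev.
have lenV g : len g^-1%g = len g.
  by apply/eqP; rewrite eqn_leq lenV_le -{1}(invgK g) lenV_le.
have len1 : len 1%g = 0%N.
  by apply/eqP; rewrite -leqn0 (leq_trans (len_le [::]))// /wlen big_nil.
have finite_wt k : finite_set [set g | (wt g <= k)%N].
  have fe : finite_set (e @^-1` `I_k).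
    by apply: finite_preimage; [move=> x y _ _; exact: e_inj|exact: finite_II].
  apply: (@sub_finite_set _ _
    ((e @^-1` `I_k) `|` ((fun g => g^-1%g) @` (e @^-1` `I_k)))).
    move=> g /=; rewrite /wt gtn_min => /orP[ek|ek]; [by left|right].
    by exists g^-1%g => //; rewrite invgK.
  by rewrite finite_setU; split => //; exact: finite_image.
(* An element of length at most k + 1 is trivial or a letter of weight at most k + 1 times an
   element of length at most k. *)
have finite_len k : finite_set [set g | (len g <= k)%N].
  elim: k => [|k IH].
    apply: (@sub_finite_set _ _ [set 1%g]); last exact: finite_set1.
    move=> g /=; have [[|x s] <- <-] := len_word g; first by [].
    by rewrite /wlen big_cons addSn.
  apply: (@sub_finite_set _ _ ([set 1%g] `|` ((fun z => z.1 * z.2)%g @`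
    ([set g | (wt g <= k.+1)%N] `*` [set g | (len g <= k)%N])))).
    move=> g /=; have [[|x s] <- <-] := len_word g; first by left.
    rewrite /wlen big_cons => xs; right; exists (x, gp s) => //; split => /=.
      by apply: leq_trans xs; rewrite leq_addr.
    apply: (leq_trans (len_le s)); rewrite -ltnS (leq_trans _ xs)//.
    by rewrite -add1n leq_add2r.
  rewrite finite_setU; split; first exact: finite_set1.
  by apply: finite_image; exact: finite_setX.
exists (fun g => (len g)%:R); split; first split.
- by rewrite len1.
- by move=> g; exact: ler0n.
- by move=> g; rewrite lenV.
- by move=> g h; rewrite -natrD ler_nat.
- move=> g /eqP; rewrite pnatr_eq0 => /eqP; have [[|x s] <- <-] := len_word g.
    by [].
  by rewrite /wlen big_cons addSn.
- move=> r; apply: sub_finite_set (finite_len (Num.bound `|r|)) => g /= gr.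
  rewrite -(ler_nat R); apply: (le_trans gr); apply: (le_trans (ler_norm r)).
  by apply/ltW/archi_boundP.
Qed.

End Existence.

Local Close Scope complex_scope.

Theorem theorem1p7 (R : realType) (BB : Banach R -> Prop) (G : groupType)
    (BB_unif_convex : uniformly_convex BB)
    (BB_dual : closed_duality BB)
    (BB_conj : closed_conjugation BB)
    (BB_ultra : closed_ultraproducts BB)
    (BB_L2 : closed_L2 BB)
    (G_countable : countable [set: G])
    (G_rf : residually_finite G)
    (G_box_monogenic : forall (N : nat -> set G) (l : G -> R),
      box_sequence N -> proper_length_function l ->
      monogenic (@box_dist R G N l)) :
  (strong_Banach_T G BB <->
   forall (N : nat -> set G) (l : G -> R),
     box_sequence N -> proper_length_function l ->
     geometric_strong_Banach_T BB (@box_dist R G N l) (@Dl R G N)) /\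
  (strong_Banach_T G BB <->
   exists (N : nat -> set G) (l : G -> R),
     [/\ box_sequence N, proper_length_function l &
         geometric_strong_Banach_T BB (@box_dist R G N l) (@Dl R G N)]).
Proof.
(* The universal statement would be vacuous without a box space; these witnesses serve both to use
   it and to prove the existential one. *)
have [N HN] := box_sequence_exists G_countable G_rf.
have [l Hl] := proper_length_function_exists G_countable R.
split; split.
- by move=> sT N' l' HN' Hl'; exact: geometric_of_strong_Banach_T.
- by move=> /(_ N l HN Hl); exact: strong_Banach_T_of_geometric.
- by move=> sT; exists N, l; split => //; exact: geometric_of_strong_Banach_T.
- by move=> [N' [l' [HN' Hl' ]]]; exact: strong_Banach_T_of_geometric.
Qed.
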